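(* Let $p\geq 7$ be a prime, let $F$ be a group of order $12$, let $\tau:F\to\mathbf{Z}_p^*$ be a group morphism, and let $G=\mathbf{Z}_p\rtimes_\tau F$. Let $K/k$ be a Galois field extension with Galois group $G$. The number of Hopf Galois structures of type $C_{12p}$ on $K/k$ is determined by $F$ and the isomorphism class of $\ker\tau$ as follows (for each entry it is assumed that $p$ is such that a morphism $\tau$ with the given kernel exists; the listed kernels are the only ones that can occur): - $F\cong C_{12}$: $1$ if $\ker\tau=F$; $p$ if $\ker\tau$ is isomorphic to $C_6$, $C_4$, $C_3$, $C_2$ or $\{1\}$. - $F\cong C_6\times C_2$: $3$ if $\ker\tau=F$; $3p$ if $\ker\tau$ is isomorphic to $C_6$, $C_2^2$ or $C_2$. - $F\cong A_4$: $0$ if $\ker\tau=F$; $0$ if $\ker\tau\cong C_2^2$. - $F\cong D_{2\cdot 6}$: $9$ if $\ker\tau=F$; $9p$ if $\ker\tau$ is isomorphic to $C_6$ or $D_{2\cdot 3}$. - $F\cong\mathrm{Dic}_{12}$: $3$ if $\ker\tau=F$; $3p$ if $\ker\tau$ is isomorphic to $C_6$ or $C_3$.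
   Context: $\mathbf{Z}_p=\mathbf{Z}/p\mathbf{Z}$, with $\mathrm{Aut}(\mathbf{Z}_p)$ identified with $\mathbf{Z}_p^*$. $C_m$ is the cyclic group of order $m$, $D_{2\cdot m}$ the dihedral group of order $2m$, $A_4$ the alternating group on four letters, and $\mathrm{Dic}_{12}=\langle x,y\mid x^3=1,y^4=1,yxy^{-1}=x^2\rangle$ the dicyclic group of order 12; these give all groups of order 12: $C_{12}$, $C_6\times C_2$, $A_4$, $D_{2\cdot 6}$, $\mathrm{Dic}_{12}$. A Hopf Galois structure on a finite field extension $K/k$ is a pair $(\mathcal{H},\mu)$ where $\mathcal{H}$ is a finite cocommutative $k$-Hopf algebra and $\mu:\mathcal{H}\to\mathrm{End}_k(K)$ is a $k$-linear map giving $K$ a left $\mathcal{H}$-module algebra structure and inducing a bijection $K\otimes_k\mathcal{H}\to\mathrm{End}_k(K)$. For $K/k$ Galois with group $G$, by Greither and Pareigis, Hopf Galois structures on $K/k$ are in bijection with regular subgroups $N$ of $\mathrm{Sym}(G)$ normalized by $\lambda(G)$, where $\lambda$ is left translation; the type of the structure is the isomorphism class of $N$. *)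

(* Defs.v *)
From HB Require Import structures.
From mathcomp Require Import all_boot all_order all_algebra.
From mathcomp Require Import all_fingroup all_solvable all_field.

Set Implicit Arguments.
Unset Strict Implicit.
Unset Printing Implicit Defensive.

Import GRing.Theory VectorInternalTheory.
Local Open Scope ring_scope.

(* Tensor products of finite-dimensional spaces, in coordinates: the matrix t  *)
(* stands for the sum of the t i j *: (e_i (x) e_j), where e_i denotes the     *)
(* canonical basis r2v (delta_mx 0 i). The map tlift b is the linear map that  *)
(* the universal property attaches to a bilinear b (tlift_tens, tlift_uniq).   *)
(* For a comultiplication d, tlift b (d h) is thus the Sweedler sum of the     *)
(* b h_(1) h_(2).                                                              *)

Section Tensor.

Variable k : fieldType.

Definition tensor (U V : vectType k) : vectType k := 'M[k]_(dim U, dim V).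

Definition tens (U V : vectType k) (u : U) (v : V) : tensor U V :=
  (v2r u)^T *m v2r v.

Definition tlift (U V : vectType k) (W : lmodType k) (b : U -> V -> W)
    (t : tensor U V) : W :=
  \sum_(i < dim U) \sum_(j < dim V)
    (t : 'M[k]_(dim U, dim V)) i j *:
      b (r2v (delta_mx 0 i)) (r2v (delta_mx 0 j)).

Let r2v_basis (U : vectType k) (u : U) :
  u = \sum_(i < dim U) v2r u 0 i *: r2v (delta_mx 0 i).
Proof.
rewrite -[LHS]v2rK [v2r u in LHS]row_sum_delta linear_sum.
by apply: eq_bigr => i _; rewrite linearZ.
Qed.

Fact tlift_tens (U V : vectType k) (W : lmodType k) (b : U -> V -> W) u v :
    (forall v', linear (b^~ v')) -> (forall u', linear (b u')) ->
  tlift b (tens u v) = b u v.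
Proof.
move=> bl br.
pose Bl v' := GRing.isLinear.Build k U W *:%R (b^~ v') (bl v').
pose fl v' : {linear U -> W} := HB.pack (b^~ v') (Bl v').
pose Br u' := GRing.isLinear.Build k V W *:%R (b u') (br u').
pose fr u' : {linear V -> W} := HB.pack (b u') (Br u').
rewrite [u in RHS](r2v_basis u) -[RHS]/(fl v _) linear_sum.
apply: eq_bigr => i _; rewrite linearZ /= -[b _ v]/(fr _ v).
rewrite [v in RHS](r2v_basis v) linear_sum scaler_sumr.
apply: eq_bigr => j _; rewrite linearZ scalerA; congr (_ *: _).
by rewrite !mxE big_ord1 !mxE.
Qed.

Fact tlift_uniq (U V : vectType k) (W : lmodType k) (b : U -> V -> W)
    (f : {linear tensor U V -> W}) :
  (forall u v, f (tens u v) = b u v) -> f =1 tlift b.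
Proof.
move=> fE t; have tE : t = \sum_(i < dim U) \sum_(j < dim V)
    (t : 'M[k]_(dim U, dim V)) i j *:
      tens (r2v (delta_mx 0 i)) (r2v (delta_mx 0 j)).
  rewrite [LHS](matrix_sum_delta t); apply: eq_bigr => i _.
  apply: eq_bigr => j _; congr (_ *: _).
  by rewrite /tens !r2vK trmx_delta mul_delta_mx.
rewrite [in LHS]tE linear_sum; apply: eq_bigr => i _; rewrite linear_sum.
by apply: eq_bigr => j _; rewrite linearZ fE.
Qed.

End Tensor.

(* An falgType is a nonzero finite-dimensional algebra; a Hopf algebra is      *)
(* never zero, since its counit is unital.                                     *)
Record cocommHopfAlgebra (k : fieldType) := CocommHopfAlgebra {
  hopf_sort :> falgType k;
  comul : {linear hopf_sort -> tensor hopf_sort hopf_sort};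
  counit : {scalar hopf_sort};
  antipode : {linear hopf_sort -> hopf_sort};
  comulA : forall h : hopf_sort,
    tlift (fun a b => tlift (fun a1 a2 => tens a1 (tens a2 b)) (comul a))
          (comul h)
    = tlift (fun a b => tens a (comul b)) (comul h);
  counitl : forall h : hopf_sort,
    tlift (fun a b => counit a *: b) (comul h) = h;
  counitr : forall h : hopf_sort,
    tlift (fun a b => counit b *: a) (comul h) = h;
  comul1 : comul 1 = tens 1 1;
  comulM : forall g h : hopf_sort,
    comul (g * h)
    = tlift (fun a b => tlift (fun c d => tens (a * c) (b * d)) (comul h))
            (comul g);
  counit1 : counit 1 = 1;
  counitM : forall g h : hopf_sort, counit (g * h) = counit g * counit h;
  antipodel : forall h : hopf_sort,
    tlift (fun a b => antipode a * b) (comul h) = (counit h)%:A;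
  antipoder : forall h : hopf_sort,
    tlift (fun a b => a * antipode b) (comul h) = (counit h)%:A;
  comulC : forall h : hopf_sort,
    tlift (fun a b => tens b a) (comul h) = comul h
}.

Arguments comul {k c}.
Arguments counit {k c}.
Arguments antipode {k c}.

Record hopfGalois (k : fieldType) (K : fieldExtType k) := HopfGalois {
  hg_alg :> cocommHopfAlgebra k;
  hg_act : {linear hg_alg -> 'End(K)};
  hg_act1 : hg_act 1 = \1%VF;
  hg_actM : forall g h : hg_alg, hg_act (g * h) = (hg_act g \o hg_act h)%VF;
  hg_act_one : forall h : hg_alg, hg_act h 1 = (counit h)%:A;
  hg_act_mul : forall (h : hg_alg) (x y : K),
    hg_act h (x * y) = tlift (fun a b => hg_act a x * hg_act b y) (comul h);
  hg_act_bij : bijective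
    (fun t : tensor K hg_alg =>
       tlift (fun x h => (amull x \o hg_act h)%VF) t)
}.

Arguments hg_act {k K} {X} : rename.

Definition hg_iso (k : fieldType) (K : fieldExtType k) (X Y : hopfGalois K) :=
  exists f : {lrmorphism X -> Y},
    [/\ bijective f,
        forall h, comul (f h) = tlift (fun a b => tens (f a) (f b)) (comul h),
        forall h, counit (f h) = counit h
      & forall h, hg_act (f h) = hg_act h].

Section GreitherPareigis.

Variables (k : fieldType) (K : splittingFieldType k).

Let G := gal_of {:K}.

(* The products of gal_of {:K} and of {perm _} are composition in diagrammatic *)
(* order: (x * y) a = y (x a). Hence left translation x |-> g o x is x * g,    *)
(* the group algebra product of n and m is n o m = (m * n)%g, and the conjugate*)
(* l o n o l^-1 is (n ^ l)%g.                                                  *)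

Definition ltrans (g : G) : {perm G} := perm (mulIg g).

Definition regular (N : {group {perm G}}) : bool :=
  [transitive N, on [set: G] | 'P] && [forall x : G, ('C_N[x | 'P] == 1)%g].

(* Elements of the group algebra K[N] are functions supported on N.            *)
Definition in_gralg (N : {group {perm G}}) (c : {ffun {perm G} -> K}) : Prop :=
  forall n, n \notin N -> c n = 0.

Definition gralg_fixed (c : {ffun {perm G} -> K}) : Prop :=
  forall g : G, g \in 'Gal({:K} / 1)%g ->
    forall n, c (n ^ ltrans g)%g = g (c n).

(* X is the Hopf Galois structure that Greither and Pareigis attach to N:      *)
(* theta is an isomorphism of Hopf algebras from X to K[N]^G, where G acts on  *)
(* K by automorphisms and on N by conjugation through left translations, and   *)
(* sum_n c_n n sends x to sum_n c_n (n^-1 (1_G)) (x).                          *)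
Definition gp_corresponds (X : hopfGalois K) (N : {group {perm G}}) : Prop :=
  exists theta : {linear X -> {ffun {perm G} -> K}},
    [/\ injective theta,
        forall c, in_gralg N c /\ gralg_fixed c <-> exists h, theta h = c,
        [/\ forall n, theta 1 n = (n == 1%g)%:R
          & forall h h' m, m \in N ->
              theta (h * h') m = \sum_(n in N) theta h n * theta h' (m * n^-1)%g],
        [/\ forall h n m,
              tlift (fun a b => theta a n * theta b m) (comul h)
              = if n == m then theta h n else 0
          & forall h, \sum_(n in N) theta h n = (counit h)%:A]
      & forall h x,
          hg_act h x = \sum_(n in N) theta h n * ((n^-1)%g 1%g : G) x].

Definition has_type (rT : finGroupType) (X : hopfGalois K) (T : {group rT}) :=
  exists N : {group {perm G}},
    [/\ regular N, ([set ltrans g | g in 'Gal({:K} / 1)] \subset 'N(N))%g,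
        gp_corresponds X N & (N \isog T)%g].

(* Hopf Galois structures are counted up to isomorphism.                       *)
Definition num_hopfGalois (rT : finGroupType) (T : {group rT}) (n : nat) :=
  exists S : 'I_n -> hopfGalois K,
    [/\ forall i, has_type (S i) T,
        forall i j, hg_iso (S i) (S j) -> i = j
      & forall X, has_type X T -> exists i, hg_iso X (S i)].

End GreitherPareigis.

Section SemidirectProduct.

Variables (p : nat) (fT : finGroupType) (F : {group fT}).
Variable tau : {morphism F >-> {unit 'Z_p}}.

(* MathComp actions are right actions, and x acts on a in sdprod_by as the     *)
(* conjugate x^-1 a x; the inverse makes x a x^-1 equal to tau x times a.      *)
Definition tau_act (a : 'Z_p) (x : fT) : 'Z_p := val ((tau x)^-1)%g * a.

Fact tau_act_is_action : is_action F tau_act.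
Proof.
split=> [x a b /= | a x y Fx Fy].
  by apply: (can_inj (mulKr (valP ((tau x)^-1)%g))).
by rewrite /tau_act morphM // invMg FinRing.val_unitM mulrA.
Qed.

Canonical tau_action := Action tau_act_is_action.

Fact tau_act_is_groupAction : is_groupAction [set: 'Z_p] tau_action.
Proof.
move=> x Fx; rewrite inE; apply/andP; split.
  by apply/subsetP => a _; rewrite inE.
by apply/morphicP => a b _ _; rewrite !actpermE; apply: mulrDr.
Qed.

Canonical tau_groupAction := GroupAction tau_act_is_groupAction.

Definition semidirect := sdprod_by tau_groupAction.

End SemidirectProduct.

(* Main.v *)
Require Import Defs.
From HB Require Import structures.
From mathcomp Require Import all_boot all_order all_algebra.
From mathcomp Require Import all_fingroup all_solvable all_field.
From mathcomp Require Import integral_char.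

(** Galois descent reduces the theorem to group theory. For a regular subgroup
    N of Sym(G) normalized by the left translations, the invariants of G in
    K[N] form a k-Hopf algebra that acts on K. A k-basis of the invariants is
    a K-basis of K[N] ([th_full], [th_free]), so the matrix of its
    coefficients is invertible; the inverse matrix gives the comultiplication,
    and each Hopf algebra identity is checked on coefficients ([th2_sep],
    [th3_sep]). Conversely the action of the Hopf algebra on K determines its
    coefficients, because distinct automorphisms are linearly independent
    ([gralg_act_coef]), and the coefficients determine N ([hg_iso_eq]). Hence
    the structures of a given type are counted by such subgroups N
    ([num_hopfGalois_gp_groups]).

    A generator of a cyclic N of order n labels the elements of G by Z/n: let
    pi x = i when the i-th power of the generator sends 1 to x. Then N is
    normalized by the translations exactly when every translation is affine in
    this labelling, pi (x g) = c pi x + pi g, and changing the generator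
    multiplies pi by a unit; so the subgroups N number 1/phi(n) times the
    bijective affine cocycles ([card_cyclic_regular]). By the Chinese remainder
    theorem such a cocycle is a triple of surjective cocycles modulo 4, 3 and p
    ([card_cocycles_mul]), and up to units each of the three is a subgroup of G:
    - modulo 3, the subgroup of index 3 where pi vanishes, which is arbitrary
      because every permutation of Z/3 is affine ([card_cocycles3]);
    - modulo 4, the subgroup of index 2 where pi is even, which is arbitrary
      because the permutations of Z/4 that respect parity are affine
      ([card_cocycles4]);
    - modulo p, the subgroup of index p where pi vanishes, a complement of the
      normal subgroup of order p ([card_cocycles_prime]).

    The number of structures is therefore the product of the numbers of
    subgroups of G of index 2, 3 and p ([card_cyclic_regular_12p]). The first
    two are the same for F; the third is 1 if tau is trivial and p otherwise,
    the complements being conjugate ([card_complements]). If F has a normal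
    Sylow 3-subgroup, it has 1 or 3 subgroups of index 2 according as its Sylow
    2-subgroups are cyclic or not ([card_index2_order12]), and 1 or 3 of index 3
    according as F is abelian or not ([card_index3_order12]). Without a normal
    subgroup of order 3, as for the alternating group, there is no subgroup of
    index 2 ([no_index2]). The possible kernels are those with a cyclic
    quotient, since tau takes values in a cyclic group. *)

Set Implicit Arguments.
Unset Strict Implicit.
Unset Printing Implicit Defensive.

Import GRing.Theory VectorInternalTheory.
Local Open Scope ring_scope.

(** * Tensor products and separating families *)

Section TensorTheory.
Variable k : fieldType.

Lemma lin_sum (V W : lmodType k) (f : V -> W) : linear f ->
  forall (I : Type) (r : seq I) (P : pred I) (a : I -> k) (x : I -> V),
  f (\sum_(i <- r | P i) a i *: x i) = \sum_(i <- r | P i) a i *: f (x i).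
Proof.
move=> fl I r P a x.
pose F : {linear V -> W} := HB.pack f (GRing.isLinear.Build k V W *:%R f fl).
by rewrite -[f]/(F : V -> W) linear_sum; apply: eq_bigr => i _; rewrite linearZ.
Qed.

Lemma lin_eq0 (V W : lmodType k) (f : V -> W) : linear f -> f 0 = 0.
Proof.
by move=> /lin_sum/(_ void [::] xpredT (fun=> 0) (fun=> 0)); rewrite !big_nil.
Qed.

Lemma linZ (V W : lmodType k) (f : V -> W) : linear f ->
  forall a x, f (a *: x) = a *: f x.
Proof. by move=> fl a x; have := fl a x 0; rewrite !addr0 (lin_eq0 fl) addr0. Qed.

Lemma linB (V W : lmodType k) (f : V -> W) : linear f ->
  forall x y, f (x - y) = f x - f y.
Proof. by move=> fl x y; rewrite -scaleN1r addrC fl scaleN1r addrC. Qed.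

Lemma basisE (V : vectType k) (u : V) :
  u = \sum_(i < dim V) v2r u 0 i *: r2v (delta_mx 0 i).
Proof.
rewrite -[LHS]v2rK [v2r u in LHS]row_sum_delta linear_sum.
by apply: eq_bigr => i _; rewrite linearZ.
Qed.

Lemma eq_tlift (U V : vectType k) (W : lmodType k) (b b' : U -> V -> W) t :
  (forall u v, b u v = b' u v) -> tlift b t = tlift b' t.
Proof.
by move=> e; do 2!apply: eq_bigr => ? _; rewrite e.
Qed.

Lemma tlift_linear (U V : vectType k) (W : lmodType k) (b : U -> V -> W) :
  linear (tlift b).
Proof.
move=> a s t; rewrite /tlift scaler_sumr -big_split /=; apply: eq_bigr => i _.
rewrite scaler_sumr -big_split /=; apply: eq_bigr => j _.
by rewrite !mxE scalerDl scalerA.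
Qed.

Lemma lin_tlift (U V : vectType k) (W W' : lmodType k) (f : W -> W')
    (b : U -> V -> W) t : linear f ->
  f (tlift b t) = tlift (fun u v => f (b u v)) t.
Proof.
move=> fl; rewrite /tlift.
transitivity (f (\sum_(i < dim U) 1 *: \sum_(j < dim V)
    (t : 'M[k]_(dim U, dim V)) i j *:
      b (r2v (delta_mx 0 i)) (r2v (delta_mx 0 j)))).
  by congr f; apply: eq_bigr => i _; rewrite scale1r.
rewrite (lin_sum fl); apply: eq_bigr => i _; rewrite scale1r (lin_sum fl).
exact: eq_bigr.
Qed.

End TensorTheory.

Section TensorField.
Variables (k : fieldType) (K : fieldExtType k).

Lemma lin_mull (V : lmodType k) (f : V -> K) (x : K) :
  linear f -> linear (fun v => x * f v).
Proof. by move=> fl a u v; rewrite fl mulrDr scalerAr. Qed.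

Lemma lin_mulr (V : lmodType k) (f : V -> K) (x : K) :
  linear f -> linear (fun v => f v * x).
Proof. by move=> fl a u v; rewrite fl mulrDl scalerAl. Qed.

(** For functionals f and g, the functional f (x) g on the tensor product,
    followed by the multiplication of K. *)
Definition pairt (U V : vectType k) (f : U -> K) (g : V -> K) :
  tensor U V -> K := tlift (fun a b => f a * g b).

Lemma pairt_linear (U V : vectType k) (f : U -> K) (g : V -> K) :
  linear (pairt f g).
Proof. exact: tlift_linear. Qed.

Lemma pairt_tens (U V : vectType k) (f : U -> K) (g : V -> K) u v :
  linear f -> linear g -> pairt f g (tens u v) = f u * g v.
Proof.
move=> fl gl; rewrite /pairt tlift_tens //= => w.
- exact: lin_mulr.
- exact: lin_mull.
Qed.

(** The functionals f s with P s span the K-dual of K (x) V: no nonzero vector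
    with coefficients in K is killed by all of them. *)
Definition kfree (V : vectType k) (S : Type) (P : S -> Prop) (f : S -> V -> K) :=
  forall w : 'I_(dim V) -> K,
    (forall s, P s -> \sum_i w i * f s (r2v (delta_mx 0 i)) = 0) ->
  forall i, w i = 0.

Definition separates (V : vectType k) (S : Type) (P : S -> Prop)
    (f : S -> V -> K) :=
  forall x y : V, (forall s, P s -> f s x = f s y) -> x = y.

(** A tensor killed by all f (x) g has rows killed by all g: freeness over K,
    rather than mere separation, is what allows the K-valued coefficients
    g (row i) to be cancelled one index i at a time. *)
Lemma tens_separates (V W : vectType k) (S T : Type) (P : S -> Prop)
    (Q : T -> Prop) (f : S -> V -> K) (g : T -> W -> K) :
    (forall t, linear (g t)) -> kfree P f -> separates Q g ->
  separates (fun st : S * T => P st.1 /\ Q st.2)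
            (fun st => pairt (f st.1) (g st.2)).
Proof.
move=> gl ff gs x y exy; apply/eqP; rewrite -subr_eq0; apply/eqP.
have {exy}: forall s t, P s -> Q t -> pairt (f s) (g t) (x - y) = 0.
  move=> s t Ps Qt; rewrite (linB (pairt_linear _ _)).
  by rewrite (exy (s, t)) // subrr.
move: (x - y) => z {x y} z0; apply/matrixP=> i j; rewrite [RHS]mxE.
pose r i : W := r2v (row i (z : 'M[k]_(_, _))).
suff r0: r i = 0.
  have := congr1 v2r r0; rewrite r2vK linear0 => /rowP/(_ j).
  by rewrite !mxE.
apply: gs => t Qt; rewrite (lin_eq0 (gl t)); move: i.
apply: ff => s Ps; rewrite -[RHS](z0 s t Ps Qt) /pairt /tlift.
apply: eq_bigr => i _; rewrite [r i]basisE (lin_sum (gl t)) mulr_suml.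
by apply: eq_bigr => l _; rewrite r2vK mxE -scalerAl mulrC.
Qed.

End TensorField.

(** * Galois descent for the group algebra *)

Section GalOf.
Variables (k : fieldType) (K : splittingFieldType k).
Local Notation G := (gal_of {:K}).

Lemma gal_full (g : G) : g \in 'Gal({:K} / 1)%g.
Proof. by rewrite gal_kHom ?sub1v // k1HomE; case: (gal_repr g). Qed.

Lemma galMf (g h : G) a : (g * h)%g a = h (g a).
Proof. by rewrite galM ?memvf. Qed.

Lemma ltransE (g x : G) : ltrans g x = (x * g)%g.
Proof. by rewrite permE. Qed.

Lemma ltransM (g h : G) : ltrans (g * h)%g = (ltrans g * ltrans h)%g.
Proof. by apply/permP=> x; rewrite permM !ltransE mulgA. Qed.

Lemma ltrans1 : ltrans (1%g : G) = 1%g.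
Proof. by apply/permP=> x; rewrite ltransE perm1 mulg1. Qed.

Lemma ltransV (g : G) : ltrans (g^-1)%g = (ltrans g)^-1%g.
Proof. by apply/eqP; rewrite eq_sym eq_invg_mul -ltransM mulgV ltrans1. Qed.

(** A k-linear left inverse of the embedding of k in K, used to turn the
    G-invariant elements of K that occur below into elements of k. *)
Definition retr (x : K) : k := coord [tuple (1 : K)] 0 x.

Lemma retr_linear : linear (retr : K -> k^o).
Proof. by move=> a x y; rewrite /retr linearP. Qed.

Lemma retrK (a : k) : retr a%:A = a.
Proof.
by rewrite /retr linearZ /= (coord_free 0) ?mulr1 // seq1_free ?oner_eq0.
Qed.

Lemma retr_fixed (galK : galois 1 {:K}) x :
  (forall g : G, g x = x) -> (retr x)%:A = x.
Proof.
move=> fx; suff /vlineP[a ->]: x \in 1%VS by rewrite retrK.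
have <- := galois_fixedField galK.
by apply/fixedFieldP; rewrite ?memvf.
Qed.

(** The trace form is nondegenerate: the sum of the automorphisms is not zero,
    by their linear independence. *)
Lemma trace_eq0 (x : K) : (forall a, \sum_(g : G) g (a * x) = 0) -> x = 0.
Proof.
move=> h; apply/eqP/contraT => x0.
have [|a _ /negP[]] := @gal_independent_contra _ _ {:K}%AS predT
   (fun g => g x) (1%g : G) isT.
  by rewrite fmorph_eq0.
by apply/eqP; rewrite -[RHS](h a); apply: eq_bigr => g _; rewrite rmorphM mulrC.
Qed.

Lemma gal_sum_eq0 (c : G -> K) :
  (forall a, \sum_(g : G) c g * g a = 0) -> forall g, c g = 0.
Proof.
move=> h g; exact: (@gal_independent _ _ {:K}%AS predT c (fun a _ => h a)).
Qed.

End GalOf.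

Section Descent.
Variables (k : fieldType) (K : splittingFieldType k).
Hypothesis galK : galois 1 {:K}.
Local Notation G := (gal_of {:K}).
Variable N : {group {perm G}}.
Hypothesis nNG : ([set ltrans g | g in 'Gal({:K} / 1)] \subset 'N(N))%g.

Lemma ltransJ (g : G) n : (n ^ ltrans g \in N)%g = (n \in N).
Proof. by rewrite memJ_norm // (subsetP nNG) // imset_f ?gal_full. Qed.

(** The sum over G of the conjugates of a [n]; these elements span the
    invariants of K[N]. *)
Definition orbtrace (n : {perm G}) (a : K) : {ffun {perm G} -> K} :=
  [ffun m => \sum_(g : G | (n ^ ltrans g)%g == m) g a].

Lemma orbtrace_in n a : n \in N -> in_gralg N (orbtrace n a).
Proof.
move=> Nn m Nm; rewrite ffunE big1 // => g /eqP e.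
by move: Nm; rewrite -e ltransJ Nn.
Qed.

Lemma orbtrace_fixed n a : gralg_fixed (orbtrace n a).
Proof.
move=> h _ m; rewrite !ffunE rmorph_sum (reindex_inj (mulIg h)) /=.
apply: eq_big => [g | g _]; last by rewrite galMf.
by rewrite ltransM conjgM (inj_eq (conjg_inj _)).
Qed.

Variables (V : vectType k) (th : {linear V -> {ffun {perm G} -> K}}).
Hypothesis th_inj : injective th.
Hypothesis th_im : forall c, in_gralg N c /\ gralg_fixed c <-> exists h, th h = c.

Lemma th_linear n : linear (fun h => th h n).
Proof. by move=> a x y; rewrite linearP !ffunE. Qed.

Lemma th_in h : in_gralg N (th h).
Proof. by have [_] := th_im (th h); case=> //; exists h. Qed.

Lemma th_fixed h (g : G) n : th h (n ^ ltrans g)%g = g (th h n).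
Proof.
have [_] := th_im (th h); case=> [|_ fx]; first by exists h.
by apply: fx; rewrite gal_full.
Qed.

(** The invariants span K[N] over K: tested on [orbtrace n a], a functional that
    kills them gives a linear relation between automorphisms. *)
Lemma th_full (v : {perm G} -> K) :
  (forall h, \sum_(n in N) v n * th h n = 0) -> forall n, n \in N -> v n = 0.
Proof.
move=> h0 n Nn.
suff /(_ 1%g): forall g : G, v (n ^ ltrans g)%g = 0 by rewrite ltrans1 conjg1.
apply: gal_sum_eq0 => a.
have [h hE] : exists h, th h = orbtrace n a.
  by apply/th_im; split; [apply: orbtrace_in | apply: orbtrace_fixed].
rewrite -[RHS](h0 h) hE.
rewrite (partition_big (fun g => n ^ ltrans g)%g (mem N)) /=; last first.
  by move=> g _; rewrite ltransJ.
apply: eq_bigr => m _; rewrite ffunE big_distrr /=.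
by apply: eq_big => // g /eqP ->.
Qed.

(** Elements of the invariants that are independent over k remain so over K:
    the trace of any multiple of a K-linear relation is a k-linear relation. *)
Lemma th_free : kfree (fun n => n \in N) (fun n h => th h n).
Proof.
move=> w w0.
have gw0 (g : G) (a : K) n : n \in N ->
    \sum_i g (a * w i) * th (r2v (delta_mx 0 i)) n = 0.
  move=> Nn; pose m := (n ^ ltrans (g^-1)%g)%g.
  have Nm : m \in N by rewrite ltransJ.
  have:= congr1 (fun x => g (a * x)) (w0 _ Nm); rewrite /= mulr0 rmorph0 => e; rewrite -[RHS]e.
  rewrite big_distrr rmorph_sum /=; apply: eq_bigr => i _.
  rewrite mulrA [RHS]rmorphM; congr (_ * _).
  by rewrite -[RHS]th_fixed /m -conjgM -ltransM mulVg ltrans1 conjg1.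
pose tr (a : K) i := \sum_(g : G) g (a * w i).
have trk a i : (retr (tr a i))%:A = tr a i.
  apply: retr_fixed => // g; rewrite rmorph_sum /= [RHS](reindex_inj (mulIg g)).
  by apply: eq_bigr => h _; rewrite galMf.
have tr0 a n : n \in N -> \sum_i tr a i * th (r2v (delta_mx 0 i)) n = 0.
  move=> Nn; under eq_bigr => i _ do rewrite mulr_suml.
  by rewrite exchange_big /= big1 // => g _; apply: gw0.
have tr00 a i : tr a i = 0.
  pose x : V := \sum_j retr (tr a j) *: r2v (delta_mx 0 j).
  suff x0 : x = 0.
    have: v2r x 0 i = 0 by rewrite x0 linear0 mxE.
    rewrite /x linear_sum summxE (bigD1 i) //= big1 => [|j ji]; last first.
      by rewrite linearZ /= r2vK !mxE eqxx eq_sym (negPf ji) mulr0.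
    rewrite linearZ /= r2vK !mxE !eqxx mulr1 addr0 => r0.
    by rewrite -trk r0 scale0r.
  apply: th_inj; rewrite linear0; apply/ffunP=> n; rewrite [RHS]ffunE.
  have [Nn|nNn] := boolP (n \in N); last exact: th_in.
  rewrite (lin_sum (th_linear n)) -[RHS](tr0 a n Nn); apply: eq_bigr => j _.
  by rewrite -[in RHS]trk -scalerAl mul1r.
by move=> i; apply: trace_eq0 => a; apply: tr00.
Qed.

Lemma th_sep : separates (fun n => n \in N) (fun n h => th h n).
Proof.
move=> x y e; apply: th_inj; apply/ffunP=> n.
have [Nn|nNn] := boolP (n \in N); first exact: e.
by rewrite !th_in.
Qed.

Lemma th2_sep : separates (fun s => s.1 \in N /\ s.2 \in N)
  (fun s => pairt (fun h => th h s.1) (fun h => th h s.2)).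
Proof. exact: (tens_separates th_linear th_free th_sep). Qed.

Lemma th3_sep : separates (fun s => s.1 \in N /\ (s.2.1 \in N /\ s.2.2 \in N))
  (fun s => pairt (fun h => th h s.1)
     (pairt (fun h => th h s.2.1) (fun h => th h s.2.2))).
Proof.
apply: (tens_separates (g := fun s => pairt (fun h => th h s.1)
  (fun h => th h s.2)) _ th_free th2_sep) => s.
exact: pairt_linear.
Qed.

End Descent.

(** * The action of the group algebra of a regular subgroup *)

Section RegularAction.
Variables (k : fieldType) (K : splittingFieldType k).
Local Notation G := (gal_of {:K}).
Variable N : {group {perm G}}.
Hypothesis nNG : ([set ltrans g | g in 'Gal({:K} / 1)] \subset 'N(N))%g.
Hypothesis regN : regular N.

(** The automorphism by which the basis element n of K[N] acts on K; regularity
    makes it a bijection from N to G. *)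
Definition gdot (n : {perm G}) : G := (n^-1)%g 1%g.

Lemma regular_fix n (x : G) : n \in N -> n x = x -> n = 1%g.
Proof.
move=> Nn nx; case/andP: regN => _ /forallP/(_ x)/eqP/setP/(_ n).
by rewrite inE Nn /= => e; apply/set1P; rewrite -e; apply/astab1P.
Qed.

Lemma gdot_inj : {in N &, injective gdot}.
Proof.
move=> n m Nn Nm e; apply/invg_inj/eqP; rewrite eq_mulgV1 invgK; apply/eqP.
apply: (@regular_fix _ 1%g); first by rewrite groupM ?groupV.
by rewrite permM -[(n^-1)%g _]/(gdot n) e /gdot permKV.
Qed.

Lemma gdot_surj g : exists2 n, n \in N & gdot n = g.
Proof.
case/andP: regN => /atransP/(_ 1%g (in_setT _)) o _.
have: g \in orbit 'P%act N 1%g by rewrite o inE.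
case/orbitP=> n Nn e; exists (n^-1)%g; rewrite ?groupV //.
by rewrite /gdot invgK -[RHS]e.
Qed.

Lemma gdot1 : gdot 1%g = 1%g.
Proof. by rewrite /gdot invg1 perm1. Qed.

(** Composing with n on the left twists m by the translation by gdot n; this twist
    is the one that the semilinear action of G undoes on invariants. *)
Lemma gdotM n m : gdot (m ^ ltrans (gdot n) * n)%g = (gdot m * gdot n)%g.
Proof.
by rewrite /gdot invMg -conjVg permM conjgE !permM ltransE -ltransV ltransE mulgV.
Qed.

Lemma card_regular : #|N| = #|{: G}|.
Proof.
rewrite -cardsT -(card_in_imset gdot_inj); apply: eq_card => g.
by rewrite inE; apply/imsetP; have [n Nn <-] := gdot_surj g; exists n.
Qed.

End RegularAction.

Lemma card_gal_full (k : fieldType) (K : splittingFieldType k) :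
  galois 1 {:K} -> #|{: gal_of {:K}}| = \dim {:K}.
Proof.
move=> galK; have := galois_dim galK; rewrite dim_vline oner_eq0 divn1 => ->.
by rewrite -cardsT; apply: eq_card => g; rewrite gal_full inE.
Qed.

Section GroupAlgebraAction.
Variables (k : fieldType) (K : splittingFieldType k).
Local Notation G := (gal_of {:K}).
Variable N : {group {perm G}}.
Hypothesis nNG : ([set ltrans g | g in 'Gal({:K} / 1)] \subset 'N(N))%g.
Hypothesis regN : regular N.

Definition gralg_act (c : {ffun {perm G} -> K}) : 'End(K) :=
  \sum_(n in N) (amull (c n) \o gdot n)%VF.

Lemma gralg_actE c x : gralg_act c x = \sum_(n in N) c n * gdot n x.
Proof.
rewrite sum_lfunE; apply: eq_bigr => n _.
by rewrite comp_lfunE lfunE.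
Qed.

Lemma gralg_act_linear : linear gralg_act.
Proof.
move=> a c d; apply/lfunP=> x.
rewrite add_lfunE scale_lfunE !gralg_actE scaler_sumr -big_split /=.
by apply: eq_bigr => n _; rewrite !ffunE mulrDl scalerAl.
Qed.

(** The coefficient of the automorphism g in the endomorphism defined by c. *)
Definition gdot_coef (M : {group {perm G}}) (c : {ffun {perm G} -> K}) (g : G) :=
  \sum_(m in M | gdot m == g) c m.

Lemma gdot_coefE c n : n \in N -> gdot_coef N c (gdot n) = c n.
Proof.
move=> Nn; rewrite /gdot_coef (bigD1 n) /= ?Nn ?eqxx // big1 ?addr0 // => l.
by case/andP=> /andP[Nl /eqP/(gdot_inj regN) e2]; rewrite e2 ?eqxx.
Qed.

Lemma gralg_act_gdot_coef c a :
  gralg_act c a = \sum_(g : G) gdot_coef N c g * g a.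
Proof.
rewrite gralg_actE (partition_big (@gdot k K) xpredT) //=; apply: eq_bigr => g _.
by rewrite mulr_suml; apply: eq_bigr => m /andP[_ /eqP <-].
Qed.

Definition gconv (c d : {ffun {perm G} -> K}) : {ffun {perm G} -> K} :=
  [ffun m => if m \in N then \sum_(n in N) c n * d (m * n^-1)%g else 0].

Definition gone : {ffun {perm G} -> K} := [ffun n => (n == 1%g)%:R].

(** The endomorphism n moves past the coefficient d m by applying gdot n to it,
    and the invariance of d turns this into a conjugation of m. *)
Lemma gralg_act_conv c d : gralg_fixed d ->
  gralg_act (gconv c d) = (gralg_act c \o gralg_act d)%VF.
Proof.
move=> fd; apply/lfunP=> x; rewrite comp_lfunE !gralg_actE.
transitivity (\sum_(n in N) \sum_(m in N) c n * d (m * n^-1)%g * gdot m x).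
  rewrite exchange_big /=; apply: eq_bigr => m Nm.
  by rewrite ffunE Nm mulr_suml.
apply: eq_bigr => n Nn; rewrite raddf_sum mulr_sumr.
rewrite (reindex_inj (mulIg n)) /= (reindex_inj (conjg_inj (ltrans (gdot n)))).
apply: eq_big => [m|m Nm]; first by rewrite groupMr // ltransJ.
by rewrite mulgK gdotM galMf fd ?gal_full // -mulrA -rmorphM.
Qed.

Lemma gralg_act_one : gralg_act gone = \1%VF.
Proof.
apply/lfunP=> x; rewrite gralg_actE id_lfunE (bigD1 1%g) //= ffunE eqxx mul1r gdot1.
by rewrite gal_id big1 ?addr0 // => n /andP[_ /negPf]; rewrite ffunE => ->; rewrite mul0r.
Qed.

Definition gralg_invariant c := in_gralg N c /\ gralg_fixed c.

Lemma gone_inv : gralg_invariant gone.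
Proof.
split=> [n|g _ n]; rewrite !ffunE.
  by case: eqP => // -> /negP[].
by rewrite rmorph_nat conjg_eq1.
Qed.

Lemma gconv_inv c d : gralg_fixed c -> gralg_fixed d -> gralg_invariant (gconv c d).
Proof.
move=> fc fd; split=> [n /negPf nN|g Gg n]; rewrite !ffunE ?nN //.
rewrite ltransJ //; case: ifP => // _; last by rewrite rmorph0.
rewrite (reindex_inj (conjg_inj (ltrans g))) rmorph_sum.
apply: eq_big => [m|m Nm]; first by rewrite ltransJ.
by rewrite -conjVg -conjMg fc // fd // rmorphM.
Qed.

End GroupAlgebraAction.

(** Dedekind independence: an endomorphism in the span of the automorphisms has
    unique coefficients, whatever regular subgroup is used to index them. *)
Lemma gralg_act_coef (k : fieldType) (K : splittingFieldType k)
    (N M : {group {perm gal_of {:K}}}) c d n m : regular N -> regular M ->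
  gralg_act N c = gralg_act M d -> n \in N -> m \in M -> gdot n = gdot m ->
  c n = d m.
Proof.
move=> rN rM e Nn Mm nm.
rewrite -(gdot_coefE rN c Nn) -(gdot_coefE rM d Mm) nm.
apply/eqP; rewrite -subr_eq0; apply/eqP.
apply: (gal_sum_eq0 (c := fun g => gdot_coef N c g - gdot_coef M d g)) => a.
have /eqP := congr1 (fun u : 'End(K) => u a) e.
rewrite !gralg_act_gdot_coef // -subr_eq0 -sumrB => /eqP e0; rewrite -[RHS]e0.
by apply: eq_bigr => g _; rewrite mulrBl.
Qed.

Lemma gralg_act_inj (k : fieldType) (K : splittingFieldType k)
    (N : {group {perm gal_of {:K}}}) c d : regular N ->
  gralg_act N c = gralg_act N d -> {in N, c =1 d}.
Proof. by move=> rN e n Nn; apply: (gralg_act_coef rN rN e). Qed.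

(** * The Hopf Galois structure attached to a regular subgroup *)

Section TliftRing.
Variables (k : fieldType) (K : fieldExtType k) (U V : vectType k).
Implicit Type t : tensor U V.

Lemma tlift_mulr (b : U -> V -> K) x t :
  tlift (fun u v => b u v * x) t = tlift b t * x.
Proof.
by rewrite (@lin_tlift _ _ _ _ _ (fun y => y * x)) // => a y z; rewrite mulrDl scalerAl.
Qed.

Lemma tlift_mull (b : U -> V -> K) x t :
  tlift (fun u v => x * b u v) t = x * tlift b t.
Proof.
by rewrite (@lin_tlift _ _ _ _ _ (fun y => x * y)) // => a y z; rewrite mulrDr scalerAr.
Qed.

Lemma tlift_sum (I : finType) (P : pred I) (b : I -> U -> V -> K) t :
  tlift (fun u v => \sum_(i | P i) b i u v) t = \sum_(i | P i) tlift (b i) t.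
Proof.
rewrite /tlift [RHS]exchange_big; apply: eq_bigr => i _.
rewrite [RHS]exchange_big; apply: eq_bigr => j _.
by rewrite scaler_sumr.
Qed.

Lemma tlift0 t : tlift (fun _ _ => 0) t = 0 :> K.
Proof. by rewrite /tlift big1 // => i _; rewrite big1 // => j _; rewrite scaler0. Qed.

End TliftRing.

Section Build.
Variables (k : fieldType) (K : splittingFieldType k).
Hypothesis galK : galois 1 {:K}.
Local Notation G := (gal_of {:K}).
Variable N : {group {perm G}}.
Hypothesis nNG : ([set ltrans g | g in 'Gal({:K} / 1)] \subset 'N(N))%g.
Hypothesis regN : regular N.
Variables (A : falgType k) (th : {linear A -> {ffun {perm G} -> K}}).
Hypothesis th_inj : injective th.
Hypothesis th_im : forall c, in_gralg N c /\ gralg_fixed c <-> exists h, th h = c.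
Hypothesis th1 : th 1 = gone K.
Hypothesis thM : forall g h, th (g * h) = gconv N (th g) (th h).

Let th_lin n : linear (fun h => th h n). Proof. exact: th_linear. Qed.
Let free := th_free galK nNG th_inj th_im.
Let sep := th_sep th_inj th_im.
Let sep2 := th2_sep galK nNG th_inj th_im.
Let sep3 := th3_sep galK nNG th_inj th_im.
Let ev2 n m := pairt (fun h : A => th h n) (fun h : A => th h m).

(** Rows are the elements of a k-basis of A, columns the elements of N. *)
Definition basis_mx : 'M[K]_(dim A, #|N|) :=
  \matrix_(i, j) th (r2v (delta_mx 0 i)) (enum_val j).

Lemma basis_mx_free : row_free basis_mx.
Proof.
apply: inj_row_free => v v0; apply/rowP=> i; rewrite mxE.
apply: (free (w := fun i => v 0 i)) => n Nn.
have := congr1 (fun u : 'rV_#|N| => u 0 (enum_rank_in Nn n)) v0.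
rewrite !mxE => e; rewrite -[RHS]e; apply: eq_bigr => j _.
by rewrite !mxE enum_rankK_in.
Qed.

Lemma basis_mx_full : row_full basis_mx.
Proof.
rewrite /row_full -mxrank_tr; apply/inj_row_free => v v0.
apply/rowP=> j; rewrite mxE.
pose w n := v 0 (enum_rank_in (enum_valP j) n).
have -> : v 0 j = w (enum_val j) by rewrite /w enum_valK_in.
apply: (th_full nNG th_im _ (enum_valP j)) => h.
rewrite [h]basisE.
have e i : \sum_(n in N) w n * th (r2v (delta_mx 0 i)) n = 0.
  have := congr1 (fun u : 'rV_(dim A) => u 0 i) v0.
  rewrite !mxE => e; rewrite -[RHS]e big_enum_val.
  apply: eq_bigr => l _.
  by rewrite !mxE /w enum_valK_in.
under eq_bigr => n _ do rewrite (lin_sum (th_lin n)) mulr_sumr.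
rewrite exchange_big big1 //= => i _.
under eq_bigr => n _ do rewrite -scalerAr.
by rewrite -scaler_sumr e scaler0.
Qed.

Let Q := pinvmx basis_mx.

(** The coordinates over K of the comultiplication: the diagonal matrix of
    the coefficients of h, moved to the basis of A by the inverse of [basis_mx]. *)
Definition comul_mx (h : A) : 'M[K]_(dim A) :=
  \matrix_(i, j) \sum_s Q s i * th h (enum_val s) * Q s j.

Lemma comul_mxE h : comul_mx h =
  Q^T *m diag_mx (\row_s th h (enum_val s)) *m Q.
Proof.
apply/matrixP=> i j; rewrite mul_mx_diag !mxE; apply: eq_bigr => s _.
by rewrite !mxE.
Qed.

(** In other words, the group elements n are grouplike: h is sent to the sum of
    the th h n (n (x) n). *)
Lemma comul_mxP h n m : n \in N -> m \in N ->
  \sum_i \sum_j comul_mx h i j *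
    (th (r2v (delta_mx 0 i)) n * th (r2v (delta_mx 0 j)) m)
  = if n == m then th h n else 0.
Proof.
move=> Nn Nm; pose a := enum_rank_in Nn n; pose b := enum_rank_in Nn m.
transitivity ((basis_mx^T *m comul_mx h *m basis_mx) a b).
  rewrite mxE exchange_big; apply: eq_bigr => j _.
  rewrite mxE mulr_suml; apply: eq_bigr => i _.
  rewrite [basis_mx j b]mxE [basis_mx^T _ _]mxE [basis_mx i a]mxE !enum_rankK_in //.
  by rewrite mulrA; congr (_ * _); apply: mulrC.
have QE : Q *m basis_mx = 1%:M by apply: mulVpmx; exact: basis_mx_full.
rewrite comul_mxE; move: (Q) QE => P PE; rewrite !mulmxA -trmx_mul PE trmx1 mul1mx -mulmxA PE mulmx1.
have -> : (n == m) = (a == b).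
  apply/eqP/eqP=> [e|/(congr1 enum_val)]; first by rewrite /b -e.
  by rewrite !enum_rankK_in.
by rewrite !mxE enum_rankK_in //; case: eqP.
Qed.

Lemma comul_mx_uniq (W W' : 'M[K]_(dim A)) :
  (forall n m, n \in N -> m \in N ->
   \sum_i \sum_j W i j *
     (th (r2v (delta_mx 0 i)) n * th (r2v (delta_mx 0 j)) m)
   = \sum_i \sum_j W' i j *
     (th (r2v (delta_mx 0 i)) n * th (r2v (delta_mx 0 j)) m)) ->
  W = W'.
Proof.
move=> e; apply/matrixP=> i j; apply/eqP; rewrite -subr_eq0; apply/eqP.
apply: (free (w := fun j => W i j - W' i j)) => m Nm; move: i {j}.
apply: free => n Nn.
under eq_bigr => i _ do rewrite mulr_suml.
have /eqP := e n m Nn Nm; rewrite -subr_eq0 -sumrB => /eqP e0.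
rewrite -[RHS]e0; apply: eq_bigr => i _; rewrite -sumrB; apply: eq_bigr => j _.
by rewrite -mulrBl -mulrA [th _ m * _]mulrC.
Qed.

(** Applying g permutes the coefficients of basis elements in the same way as
    those of h, so the defining system [comul_mxP] is preserved, and its
    solution is unique. *)
Lemma comul_mx_fixed h (g : G) i j : g (comul_mx h i j) = comul_mx h i j.
Proof.
suff /matrixP/(_ i j): map_mx g (comul_mx h) = comul_mx h by rewrite mxE.
apply: comul_mx_uniq => n m Nn Nm; rewrite comul_mxP //.
pose f n := (n ^ ltrans (g^-1)%g)%g.
have fN l : l \in N -> f l \in N by rewrite ltransJ.
have fE v l : th v l = g (th v (f l)).
  by rewrite -(th_fixed th_im) /f -conjgM -ltransM mulVg ltrans1 conjg1.
have := congr1 g (comul_mxP h (fN _ Nn) (fN _ Nm)).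
rewrite rmorph_sum (inj_eq (conjg_inj _)) => e.
transitivity (g (if n == m then th h (f n) else 0)); last first.
  by case: eqP => _; rewrite ?rmorph0 // -fE.
rewrite -e; apply: eq_bigr => i' _; rewrite rmorph_sum; apply: eq_bigr => j' _.
by rewrite !rmorphM /= -!fE mxE.
Qed.

Definition comul_fun (h : A) : tensor A A :=
  \matrix_(i, j) retr (comul_mx h i j).

Lemma comul_linear : linear comul_fun.
Proof.
move=> a x y; apply/matrixP=> i j.
rewrite [LHS]mxE [RHS]mxE [(a *: comul_fun x) i j]mxE [comul_fun x i j]mxE.
rewrite [comul_fun y i j]mxE -[RHS](retr_linear a (comul_mx x i j) (comul_mx y i j)); congr retr.
rewrite [LHS]mxE [comul_mx x i j]mxE [comul_mx y i j]mxE scaler_sumr -big_split; apply: eq_bigr => s _ /=.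
by rewrite linearP !ffunE mulrDr mulrDl -scalerAr -scalerAl.
Qed.

(** The coefficient of the comultiplication at n (x) m; all identities below are
    deduced from this formula and from the separation of tensors. *)
Lemma ev2_comul n m h : ev2 n m (comul_fun h) = if n == m then th h n else 0.
Proof.
have [Nn|nNn] := boolP (n \in N); last first.
  have t0 v : th v n = 0 by apply: (th_in th_im).
  rewrite t0 if_same /ev2 /pairt /tlift big1 // => i _; rewrite big1 // => j _.
  by rewrite t0 mul0r scaler0.
have [Nm|nNm] := boolP (m \in N); last first.
  have t0 v : th v m = 0 by apply: (th_in th_im).
  have -> : (n == m) = false by apply: contraNF nNm => /eqP<-.
  rewrite /ev2 /pairt /tlift big1 // => i _; rewrite big1 // => j _.
  by rewrite t0 mulr0 scaler0.
rewrite -comul_mxP // /ev2 /pairt /tlift; apply: eq_bigr => i _.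
apply: eq_bigr => j _; rewrite mxE.
rewrite -[in RHS](retr_fixed galK (fun g => comul_mx_fixed h g i j)).
by rewrite -scalerAl mul1r.
Qed.

Definition counit_fun (h : A) : k := retr (\sum_(n in N) th h n).

Lemma counitE h : (counit_fun h)%:A = \sum_(n in N) th h n.
Proof.
apply: retr_fixed => // g; rewrite rmorph_sum [RHS](reindex_inj (conjg_inj (ltrans g))).
apply: eq_big => [n|n _]; first by rewrite ltransJ.
by rewrite (th_fixed th_im).
Qed.

Lemma counit_linear : linear (counit_fun : A -> k^o).
Proof.
move=> a x y; rewrite -[RHS](retr_linear a (\sum_(n in N) th x n) (\sum_(n in N) th y n)).
apply: (congr1 (@retr k K)).
rewrite scaler_sumr -big_split; apply: eq_bigr => n _ /=.
by rewrite linearP !ffunE.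
Qed.

Lemma antipode_subproof (h : A) :
  exists h', th h' == [ffun n => th h (n^-1)%g].
Proof.
suff /th_im[h' e]: in_gralg N [ffun n => th h (n^-1)%g] /\
     gralg_fixed [ffun n => th h (n^-1)%g] by exists h'; apply/eqP.
split=> [n nN|g _ n]; rewrite !ffunE; first by rewrite (th_in th_im) ?groupV.
by rewrite -conjVg (th_fixed th_im).
Qed.

Definition antipode_fun h := xchoose (antipode_subproof h).

Lemma antipodeE h n : th (antipode_fun h) n = th h (n^-1)%g.
Proof. by rewrite (eqP (xchooseP (antipode_subproof h))) ffunE. Qed.

Lemma antipode_linear : linear antipode_fun.
Proof.
move=> a x y; apply: th_inj; apply/ffunP=> n.
by rewrite linearP !ffunE !antipodeE linearP !ffunE.
Qed.

Lemma th_mulE g h n : n \in N ->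
  th (g * h) n = \sum_(l in N) th g l * th h (n * l^-1)%g.
Proof. by move=> Nn; rewrite thM ffunE Nn. Qed.

Lemma counit_scale h x : counit_fun h *: x = (\sum_(n in N) th h n) * x.
Proof. by rewrite -counitE -scalerAl mul1r. Qed.

Lemma comulA_fun h :
    tlift (fun a b => tlift (fun a1 a2 => tens a1 (tens a2 b)) (comul_fun a))
          (comul_fun h)
    = tlift (fun a b => tens a (comul_fun b)) (comul_fun h).
Proof.
apply: sep3 => -[n [m l]] /= [Nn [Nm Nl]].
rewrite !(lin_tlift _ _ (pairt_linear _ _)).
transitivity (if (n == m) && (m == l) then th h n else 0).
  transitivity (tlift (fun u v => ev2 n m (comul_fun u) * th v l) (comul_fun h)).
    apply: eq_tlift => u v; rewrite (lin_tlift _ _ (pairt_linear _ _)).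
    rewrite -tlift_mulr; apply: eq_tlift => u1 v1.
    by rewrite !pairt_tens ?mulrA //; apply: pairt_linear.
  transitivity (if n == m then ev2 n l (comul_fun h) else 0).
    have [<-|nm] := eqVneq n m; first by apply: eq_tlift => u v; rewrite ev2_comul eqxx.
    rewrite -(tlift0 K (comul_fun h)); apply: eq_tlift => u v.
    by rewrite ev2_comul (negPf nm) mul0r.
  by have [<-|] := eqVneq n m; rewrite ?ev2_comul.
symmetry.
transitivity (tlift (fun u v => th u n * ev2 m l (comul_fun v)) (comul_fun h)).
  by apply: eq_tlift => u v; rewrite pairt_tens //; apply: pairt_linear.
transitivity (if m == l then ev2 n m (comul_fun h) else 0).
  have [<-|nm] := eqVneq m l; first by apply: eq_tlift => u v; rewrite ev2_comul eqxx.
  rewrite -(tlift0 K (comul_fun h)); apply: eq_tlift => u v.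
  by rewrite ev2_comul (negPf nm) mulr0.
by rewrite ev2_comul andbC; case: (m == l).
Qed.

Lemma counitl_fun h :
  tlift (fun a b => counit_fun a *: b) (comul_fun h) = h.
Proof.
apply: sep => n Nn; rewrite (lin_tlift _ _ (th_lin n)).
transitivity (\sum_(m in N) ev2 m n (comul_fun h)).
  rewrite -tlift_sum; apply: eq_tlift => u v.
  by rewrite linearZ ffunE counit_scale mulr_suml.
rewrite (bigD1 n) //= ev2_comul eqxx big1 ?addr0 // => m /andP[_ /negPf mn].
by rewrite ev2_comul mn.
Qed.

Lemma comulC_fun h : tlift (fun a b => tens b a) (comul_fun h) = comul_fun h.
Proof.
apply: sep2 => -[n m] /= [Nn Nm]; rewrite (lin_tlift _ _ (pairt_linear _ _)).
transitivity (ev2 m n (comul_fun h)).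
  by apply: eq_tlift => u v; rewrite pairt_tens // mulrC.
by rewrite -/(ev2 n m _) !ev2_comul eq_sym; case: eqP => // ->.
Qed.

Lemma counitr_fun h :
  tlift (fun a b => counit_fun b *: a) (comul_fun h) = h.
Proof.
apply: sep => n Nn; rewrite (lin_tlift _ _ (th_lin n)).
transitivity (\sum_(m in N) ev2 n m (comul_fun h)).
  rewrite -tlift_sum; apply: eq_tlift => u v.
  rewrite linearZ ffunE counit_scale mulr_suml; apply: eq_bigr => m _.
  exact: mulrC.
rewrite (bigD1 n) //= ev2_comul eqxx big1 ?addr0 // => m /andP[_ /negPf mn].
by rewrite ev2_comul eq_sym mn.
Qed.

Lemma comul1_fun : comul_fun 1 = tens 1 1.
Proof.
apply: sep2 => -[n m] /= [Nn Nm]; rewrite -/(ev2 n m _) ev2_comul pairt_tens //.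
rewrite th1 !ffunE; have [<-|nm] := eqVneq n m.
  by case: (n == 1%g); rewrite ?mulr1 ?mulr0.
have [n1|_] := eqVneq n 1%g; last by rewrite mul0r.
by rewrite mul1r -n1 eq_sym (negPf nm).
Qed.

Lemma comulM_fun g h : comul_fun (g * h)
    = tlift (fun a b => tlift (fun c d => tens (a * c) (b * d)) (comul_fun h))
            (comul_fun g).
Proof.
apply: sep2 => -[n m] /= [Nn Nm]; rewrite -/(ev2 n m _) ev2_comul.
rewrite (lin_tlift _ _ (pairt_linear _ _)).
transitivity (\sum_(l in N) \sum_(l' in N)
   ev2 l l' (comul_fun g) * ev2 (n * l^-1)%g (m * l'^-1)%g (comul_fun h)).
  have -> : \sum_(l in N) \sum_(l' in N)
     ev2 l l' (comul_fun g) * ev2 (n * l^-1)%g (m * l'^-1)%g (comul_fun h) =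
     \sum_(l in N) th g l * (if n == m then th h (n * l^-1)%g else 0).
    apply: eq_bigr => l Nl; rewrite (bigD1 l) //= !ev2_comul eqxx.
    rewrite (inj_eq (mulIg _)) big1 ?addr0 // => l' /andP[_ /negPf ll'].
    by rewrite ev2_comul eq_sym ll' mul0r.
  rewrite th_mulE //; case: ifP => // _.
  by under [RHS]eq_bigr => l _ do rewrite mulr0; rewrite big1.
under eq_bigr => l _ do under eq_bigr => l' _ do rewrite -tlift_mulr.
under eq_bigr => l _ do rewrite -tlift_sum.
rewrite -tlift_sum; apply: eq_tlift => a b.
rewrite (lin_tlift _ _ (pairt_linear _ _)).
under eq_bigr => l _ do under eq_bigr => l' _ do rewrite -tlift_mull.
under eq_bigr => l _ do rewrite -tlift_sum.
rewrite -tlift_sum; apply: eq_tlift => c d.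
rewrite pairt_tens // !th_mulE // big_distrlr /=.
by do 2!apply: eq_bigr => ? _; rewrite mulrACA.
Qed.

Lemma counit1_fun : counit_fun 1 = 1.
Proof.
rewrite -[RHS](retrK K 1) /counit_fun; apply: congr1.
rewrite th1 (bigD1 1%g) //= ffunE eqxx scale1r big1 ?addr0 // => n.
by case/andP=> _ /negPf n1; rewrite ffunE n1.
Qed.

Lemma counitM_fun g h : counit_fun (g * h) = counit_fun g * counit_fun h.
Proof.
rewrite -[LHS](retrK K) -[RHS](retrK K); apply: congr1.
rewrite -scalerA !counit_scale !mulr1 mulr_suml.
transitivity (\sum_(l in N) \sum_(n in N) th g l * th h (n * l^-1)%g).
  by rewrite exchange_big; apply: eq_bigr => n Nn; rewrite th_mulE.
apply: eq_bigr => l Nl; rewrite -mulr_sumr; congr (_ * _).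
rewrite (reindex_inj (mulIg l)) /=.
by apply: eq_big => [n|n _]; rewrite ?groupMr // mulgK.
Qed.

Lemma th_unit h n : th (counit_fun h)%:A n =
  if n == 1%g then \sum_(l in N) th h l else 0.
Proof.
rewrite linearZ ffunE th1 ffunE counit_scale.
by case: eqP; rewrite ?mulr1 ?mulr0.
Qed.

Lemma sum_inv h : \sum_(l in N) th h (l^-1)%g = \sum_(l in N) th h l.
Proof.
by rewrite (reindex_inj invg_inj); apply: eq_big => [l|l _]; rewrite ?groupV ?invgK.
Qed.

Lemma antipodel_fun h :
  tlift (fun a b => antipode_fun a * b) (comul_fun h) = (counit_fun h)%:A.
Proof.
apply: sep => n Nn; rewrite (lin_tlift _ _ (th_lin n)) th_unit.
transitivity (\sum_(l in N) ev2 (l^-1)%g (n * l^-1)%g (comul_fun h)).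
  rewrite -tlift_sum; apply: eq_tlift => a b.
  by rewrite th_mulE //; apply: eq_bigr => l _; rewrite antipodeE.
under eq_bigr => l _ do rewrite ev2_comul -{1}[(l^-1)%g]mul1g (inj_eq (mulIg _)) eq_sym.
by case: eqP => _; [apply: sum_inv | rewrite big1].
Qed.

Lemma antipoder_fun h :
  tlift (fun a b => a * antipode_fun b) (comul_fun h) = (counit_fun h)%:A.
Proof.
apply: sep => n Nn; rewrite (lin_tlift _ _ (th_lin n)) th_unit.
transitivity (\sum_(l in N) ev2 l (l * n^-1)%g (comul_fun h)).
  rewrite -tlift_sum; apply: eq_tlift => a b.
  by rewrite th_mulE //; apply: eq_bigr => l _; rewrite antipodeE invMg invgK.
under eq_bigr => l _ do
  rewrite ev2_comul -{1}[l]mulg1 (inj_eq (mulgI _)) eq_sym invg_eq1.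
by case: eqP => _; [| rewrite big1].
Qed.

Let comul_f : {linear A -> tensor A A} :=
  HB.pack comul_fun (GRing.isLinear.Build k A (tensor A A) *:%R comul_fun comul_linear).

Let counit_f : {scalar A} :=
  HB.pack counit_fun (GRing.isLinear.Build k A k *%R counit_fun counit_linear).

Let antipode_f : {linear A -> A} :=
  HB.pack antipode_fun (GRing.isLinear.Build k A A *:%R antipode_fun antipode_linear).

Definition gp_hopf : cocommHopfAlgebra k :=
  @CocommHopfAlgebra k A comul_f counit_f antipode_f comulA_fun counitl_fun
    counitr_fun comul1_fun comulM_fun counit1_fun counitM_fun antipodel_fun
    antipoder_fun comulC_fun.

Definition gp_act (h : A) : 'End(K) := gralg_act N (th h).

Lemma gp_act_linear : linear gp_act.
Proof. by move=> a x y; rewrite /gp_act linearP gralg_act_linear. Qed.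

Let act_f : {linear A -> 'End(K)} :=
  HB.pack gp_act (GRing.isLinear.Build k A 'End(K) *:%R gp_act gp_act_linear).

Lemma gp_act1 : gp_act 1 = \1%VF.
Proof. by rewrite /gp_act th1 gralg_act_one. Qed.

Lemma gp_actM g h : gp_act (g * h) = (gp_act g \o gp_act h)%VF.
Proof.
rewrite /gp_act thM gralg_act_conv // => x _ n; exact: (th_fixed th_im).
Qed.

Lemma gp_act_one h : gp_act h 1 = (counit_fun h)%:A.
Proof.
rewrite /gp_act gralg_actE counitE; apply: eq_bigr => n _.
by rewrite rmorph1 mulr1.
Qed.

Lemma gp_act_mul h x y : gp_act h (x * y) =
  tlift (fun a b => gp_act a x * gp_act b y) (comul_fun h).
Proof.
transitivity (\sum_(n in N) \sum_(m in N)
  ev2 n m (comul_fun h) * (gdot n x * gdot m y)).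
  rewrite /gp_act gralg_actE; apply: eq_bigr => n Nn.
  rewrite (bigD1 n) //= ev2_comul eqxx rmorphM big1 ?addr0 // => m.
  by case/andP=> _ /negPf mn; rewrite ev2_comul eq_sym mn mul0r.
under eq_bigr => l _ do under eq_bigr => l' _ do rewrite -tlift_mulr.
under eq_bigr => l _ do rewrite -tlift_sum.
rewrite -tlift_sum; apply: eq_tlift => a b.
rewrite /gp_act !gralg_actE big_distrlr /=.
by do 2!apply: eq_bigr => ? _; rewrite mulrACA.
Qed.

(** Both equal the order of G: the first because [basis_mx] is invertible, hence
    square, and the second because K is Galois over k. *)
Lemma gp_dim : dim A = dim K.
Proof.
rewrite -[RHS]dimvf -card_gal_full // -(card_regular regN).
by rewrite -(eqP basis_mx_free) (eqP basis_mx_full).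
Qed.

(** The kernel is trivial: independence of automorphisms reduces a relation to
    one between the rows of [basis_mx], which are free. The dimensions agree. *)
Lemma gp_act_bij : bijective
    (fun t : tensor K A => tlift (fun x h => (amull x \o gp_act h)%VF) t).
Proof.
set f := (X in bijective X).
have fl : linear f by apply: tlift_linear.
pose F : {linear tensor K A -> 'End(K)} := HB.pack f
  (GRing.isLinear.Build k (tensor K A) 'End(K) *:%R f fl).
pose L := linfun F.
have LE : L =1 f by move=> t; rewrite lfunE.
have kL : lker L == 0%VS.
  rewrite -subv0; apply/subvP=> t; rewrite memv_ker LE memv0 => /eqP t0.
  pose w j : K := \sum_i (t : 'M[k]_(_, _)) i j *: r2v (delta_mx 0 i).
  have w0 j : w j = 0.
    apply: (free (w := w)) => n Nn {j}.
    pose c : {ffun {perm G} -> K} := [ffun n => \sum_j w j * th (r2v (delta_mx 0 j)) n].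
    have /(gralg_act_inj regN)/(_ n Nn): gralg_act N c = gralg_act N 0.
      apply/lfunP=> x; rewrite !gralg_actE.
      rewrite [RHS]big1 => [|m _]; last by rewrite ffunE mul0r.
      have := congr1 (fun u : 'End(K) => u x) t0; rewrite zero_lfunE => e.
      rewrite -[RHS]e /f /tlift exchange_big /= sum_lfunE.
      under [LHS]eq_bigr => m _ do rewrite ffunE mulr_suml.
      rewrite exchange_big /=; apply: eq_bigr => j _.
      rewrite sum_lfunE.
      transitivity (w j * gp_act (r2v (delta_mx 0 j)) x).
        by rewrite /gp_act gralg_actE mulr_sumr; apply: eq_bigr => m _; rewrite mulrA.
      rewrite mulr_suml; apply: eq_bigr => i _.
      by rewrite scale_lfunE comp_lfunE lfunE scalerAl.
    by rewrite !ffunE.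
  apply/eqP/matrixP=> i j; rewrite [RHS]mxE.
  have := congr1 v2r (w0 j); rewrite linear0 => /rowP/(_ i); rewrite [RHS]mxE => e.
  rewrite -[RHS]e /w linear_sum summxE (bigD1 i) //= linearZ /= r2vK !mxE !eqxx mulr1.
  rewrite big1 ?addr0 // => l li.
  by rewrite linearZ /= r2vK !mxE eq_sym (negPf li) mulr0.
have iL : limg L = fullv.
  apply/eqP; rewrite eqEdim subvf /= limg_dim_eq; last by rewrite (eqP kL) capv0.
  by rewrite !dimvf /= /dim /= -/(dim A) gp_dim.
exists L^-1%VF => [t|u]; first by rewrite -LE lker0_lfunK.
by rewrite -LE limg_lfunVK // iL memvf.
Qed.

Definition gp_hopfGalois : hopfGalois K :=
  @HopfGalois k K gp_hopf act_f gp_act1 gp_actM gp_act_one gp_act_mul gp_act_bij.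

Lemma gp_hopfGaloisP : gp_corresponds gp_hopfGalois N.
Proof.
exists th; split=> //.
- split=> [n|h h' m Nm]; [by rewrite th1 ffunE | by rewrite th_mulE].
- by split=> [h n m|h]; [apply: ev2_comul | rewrite counitE].
- by move=> h x; rewrite /= /gp_act gralg_actE.
Qed.

End Build.

(** * The algebra of invariants *)

Section InvariantAlgebra.
Variables (k : fieldType) (K : splittingFieldType k).
Local Notation G := (gal_of {:K}).
Variable N : {group {perm G}}.
Hypothesis nNG : ([set ltrans g | g in 'Gal({:K} / 1)] \subset 'N(N))%g.
Hypothesis regN : regular N.
Local Notation gralg := {ffun {perm G} -> K}.

(** Vanishes exactly when c is supported on N. *)
Definition off_part (c : gralg) : gralg := [ffun n => if n \in N then 0 else c n].

(** Vanishes exactly when c is invariant under g. *)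
Definition twist (g : G) (c : gralg) : gralg :=
  [ffun n => c (n ^ ltrans g)%g - g (c n)].

Lemma off_part_linear : linear off_part.
Proof.
move=> a c d; apply/ffunP=> n; rewrite !ffunE.
by case: ifP; rewrite // scaler0 addr0.
Qed.

Lemma twist_linear g : linear (twist g).
Proof.
move=> a c d; apply/ffunP=> n; rewrite !ffunE linearP scalerBr.
by rewrite opprD addrACA.
Qed.

HB.instance Definition _ := GRing.isLinear.Build k gralg gralg *:%R off_part off_part_linear.
HB.instance Definition _ g := GRing.isLinear.Build k gralg gralg *:%R (twist g) (twist_linear g).

Definition invspace : {vspace gralg} :=
  (lker (linfun off_part) :&: \bigcap_(g : G) lker (linfun (twist g)))%VS.

Lemma invspaceP c : reflect (gralg_invariant N c) (c \in invspace).
Proof.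
apply: (iffP memv_capP); rewrite memv_ker lfunE /= => -[c0 cG].
  split=> [n /negPf nN|g _ n].
    by have /eqP/ffunP/(_ n) := c0; rewrite !ffunE nN.
  move: cG; rewrite memvE => /subv_bigcapP/(_ g isT); rewrite -memvE memv_ker lfunE.
  by move/eqP/ffunP/(_ n)/eqP; rewrite !ffunE subr_eq0 => /eqP.
split; first by apply/eqP/ffunP=> n; rewrite !ffunE; case: ifPn => // /c0.
rewrite memvE; apply/subv_bigcapP=> g _; rewrite -memvE memv_ker lfunE /=.
by apply/eqP/ffunP=> n; rewrite !ffunE cG ?gal_full // subrr.
Qed.

Local Notation H := (subvs_of invspace).
Implicit Types u v w : H.

Lemma invP u : gralg_invariant N (vsval u).
Proof. exact/invspaceP/subvsP. Qed.

Definition inv_mul u v : H := vsproj invspace (gconv N (vsval u) (vsval v)).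
Definition inv_one : H := vsproj invspace (gone K).

Lemma val_inv_mul u v : vsval (inv_mul u v) = gconv N (vsval u) (vsval v).
Proof.
by rewrite /inv_mul vsprojK //; apply/invspaceP/gconv_inv; [|case: (invP u)|case: (invP v)].
Qed.

Lemma val_inv_one : vsval inv_one = gone K.
Proof. by rewrite /inv_one vsprojK //; apply/invspaceP/gone_inv. Qed.

(** The action on K is faithful, so the algebra laws of the invariants follow
    from those of composition. *)
Lemma inv_act_inj : injective (fun u => gralg_act N (vsval u)).
Proof.
move=> u v e; apply/val_inj/ffunP=> n.
have [Nn|nN] := boolP (n \in N); first exact: (gralg_act_inj regN e).
by have [-> //] := invP u; have [-> //] := invP v.
Qed.

Let act_mul u v : gralg_act N (vsval (inv_mul u v)) =
  (gralg_act N (vsval u) \o gralg_act N (vsval v))%VF.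
Proof. by rewrite val_inv_mul gralg_act_conv //; case: (invP v). Qed.

Let act_add u v : gralg_act N (vsval (u + v)) =
  gralg_act N (vsval u) + gralg_act N (vsval v).
Proof. by rewrite -[u]scale1r linearP gralg_act_linear !scale1r. Qed.

Let act_one : gralg_act N (vsval inv_one) = \1%VF.
Proof. by rewrite val_inv_one gralg_act_one. Qed.

Let act_scale a u : gralg_act N (vsval (a *: u)) = a *: gralg_act N (vsval u).
Proof. by rewrite linearZ (linZ (@gralg_act_linear _ _ _)). Qed.

Lemma inv_mulA : associative inv_mul.
Proof. by move=> u v w; apply: inv_act_inj; rewrite !act_mul comp_lfunA. Qed.
Lemma inv_mul1l : left_id inv_one inv_mul.
Proof. by move=> u; apply: inv_act_inj; rewrite act_mul act_one comp_lfun1l. Qed.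
Lemma inv_mul1r : right_id inv_one inv_mul.
Proof. by move=> u; apply: inv_act_inj; rewrite act_mul act_one comp_lfun1r. Qed.
Lemma inv_mulDl : left_distributive inv_mul +%R.
Proof. by move=> u v w; apply: inv_act_inj; rewrite act_add !act_mul act_add comp_lfunDl. Qed.
Lemma inv_mulDr : right_distributive inv_mul +%R.
Proof. by move=> u v w; apply: inv_act_inj; rewrite act_add !act_mul act_add comp_lfunDr. Qed.
Lemma inv_one_neq0 : inv_one != 0.
Proof.
apply/eqP=> /(congr1 vsval); rewrite val_inv_one linear0 => /ffunP/(_ 1%g)/eqP.
by rewrite !ffunE eqxx oner_eq0.
Qed.
Lemma inv_scaleAl a u v : a *: inv_mul u v = inv_mul (a *: u) v.
Proof. by apply: inv_act_inj; rewrite act_scale !act_mul act_scale comp_lfunZl. Qed.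
Lemma inv_scaleAr a u v : a *: inv_mul u v = inv_mul u (a *: v).
Proof. by apply: inv_act_inj; rewrite act_scale !act_mul act_scale comp_lfunZr. Qed.

Definition inv_nzring_mixin := GRing.Zmodule_isNzRing.Build H
  inv_mulA inv_mul1l inv_mul1r inv_mulDl inv_mulDr inv_one_neq0.
Definition inv_nzring : nzRingType := HB.pack H inv_nzring_mixin.
Definition inv_lalg_mixin := GRing.Lmodule_isLalgebra.Build k inv_nzring inv_scaleAl.
Definition inv_lalg : lalgType k := HB.pack H inv_nzring inv_lalg_mixin.
Definition inv_alg_mixin := GRing.Lalgebra_isAlgebra.Build k inv_lalg inv_scaleAr.
Definition inv_alg : algType k := HB.pack H inv_lalg inv_alg_mixin.
Definition inv_falg_mixin := Algebra_isFalgebra.Build k inv_alg.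
Definition inv_falg : falgType k := HB.pack H inv_alg inv_falg_mixin.

Definition inv_val : {linear inv_falg -> gralg} := vsval : {linear H -> gralg}.

Lemma inv_val_im c : in_gralg N c /\ gralg_fixed c <-> exists h, inv_val h = c.
Proof.
split=> [/invspaceP cU|[h <-]]; last exact: invP.
by exists (vsproj invspace c : H); apply: vsprojK.
Qed.

End InvariantAlgebra.

(** * Hopf Galois structures and regular subgroups *)

Section Classification.
Variables (k : fieldType) (K : splittingFieldType k).
Hypothesis galK : galois 1 {:K}.
Local Notation G := (gal_of {:K}).
Implicit Types (N M : {group {perm G}}) (X Y : hopfGalois K).
Local Notation normalized N :=
  ([set ltrans g | g in 'Gal({:K} / 1)] \subset 'N(N))%g.

Definition gp_structure N (nNG : normalized N) (regN : regular N) : hopfGalois K :=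
  @gp_hopfGalois k K galK N nNG regN (inv_falg nNG regN) (inv_val nNG regN)
    (@subvs_inj _ _ _) (inv_val_im nNG regN) (val_inv_one N) (val_inv_mul nNG).

Lemma gp_structureP N (nNG : normalized N) (regN : regular N) :
  gp_corresponds (gp_structure nNG regN) N.
Proof. exact: gp_hopfGaloisP. Qed.

(** Both algebras are identified with the same invariants in K[N]. *)
Lemma gp_corresponds_iso X Y N : normalized N ->
  gp_corresponds X N -> gp_corresponds Y N -> hg_iso X Y.
Proof.
move=> nNG [tX [iX imX [X1 XM] [Xd Xe] Xa]] [tY [iY imY [Y1 YM] [Yd Ye] Ya]].
have ex h : exists h', tY h' == tX h.
  suff /imY[h' e]: in_gralg N (tX h) /\ gralg_fixed (tX h) by exists h'; apply/eqP.
  by apply/imX; exists h.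
pose f h := xchoose (ex h).
have fE h : tY (f h) = tX h by apply/eqP/(xchooseP (ex h)).
have fl : linear f by move=> a x y; apply: iY; rewrite linearP !fE linearP.
have f1 : f 1 = 1.
  by apply: iY; apply/ffunP=> n; rewrite fE X1 Y1.
have fM : {morph f : x y / x * y}.
  move=> x y; apply: iY; apply/ffunP=> n.
  have [Nn|nN] := boolP (n \in N); first by rewrite fE XM // YM // !fE.
  by rewrite !(th_in imY).
pose F : {lrmorphism X -> Y} := HB.pack f (GRing.isLinear.Build k X Y *:%R f fl)
  (GRing.isMonoidMorphism.Build X Y f (conj f1 fM)).
exists F; split=> [|h|h|h] /=.
- have ex' h : exists h', tX h' == tY h.
    suff /imX[h' e]: in_gralg N (tY h) /\ gralg_fixed (tY h) by exists h'; apply/eqP.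
    by apply/imY; exists h.
  exists (fun h => xchoose (ex' h)) => h.
  + by apply: iX; rewrite (eqP (xchooseP (ex' _))) fE.
  + by apply: iY; rewrite fE (eqP (xchooseP (ex' _))).
- apply: (th2_sep galK nNG iY imY) => -[n m] /= _; rewrite [LHS]Yd fE.
  rewrite (lin_tlift _ _ (pairt_linear _ _)) -Xd; apply: eq_tlift => a b.
  by rewrite pairt_tens ?fE //; apply: th_linear.
- rewrite -[LHS](retrK K) -[RHS](retrK K) -Ye -Xe; apply: congr1.
  by apply: eq_bigr => n _; rewrite fE.
- by apply/lfunP=> x; rewrite Xa Ya; apply: eq_bigr => n _; rewrite fE.
Qed.

Lemma gdotJ (n : {perm G}) (g : G) :
  gdot (n ^ ltrans g)%g = (n^-1%g (g^-1)%g * g)%g.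
Proof.
by rewrite /gdot -conjVg conjgE -ltransV !permM !ltransE mul1g.
Qed.

(** Equality of the actions matches the coefficient at n with the coefficient at
    the element m of M acting by the same automorphism. Since invariants
    separate the elements of M, this matching commutes with conjugation by
    translations, and an element n of N is recovered from the automorphisms
    attached to its conjugates ([gdotJ]); hence n = m. *)
Lemma hg_iso_sub X Y N M : normalized N -> regular N -> normalized M ->
    regular M -> gp_corresponds X N -> gp_corresponds Y M -> hg_iso X Y ->
  N \subset M.
Proof.
move=> nN rN nM rM [tX [iX imX _ _ Xa]] [tY [iY imY _ _ Ya]].
move=> [f [[f' _ fK] _ _ fa]].
have act h : gralg_act N (tX h) = gralg_act M (tY (f h)).
  by apply/lfunP=> x; rewrite !gralg_actE -Xa -Ya fa.
have coef h n m : n \in N -> m \in M -> gdot n = gdot m -> tX h n = tY (f h) m.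
  by move=> Nn Mm; apply: (gralg_act_coef rN rM (act h)).
have sepM m l : m \in M -> l \in M -> (forall h, tY h m = tY h l) -> m = l.
  move=> Mm Ml e; apply/eqP/contraT => /negPf ml.
  (* A functional that would vanish on all the invariants. *)
  pose v n : K := (n == m)%:R - (n == l)%:R.
  suff: v m = 0 by rewrite /v eqxx ml subr0 => /eqP; rewrite oner_eq0.
  apply: (th_full nM imY) => // h.
  under eq_bigr => n _ do rewrite mulrBl.
  have delta p : p \in M -> \sum_(n in M) (n == p)%:R * tY h n = tY h p.
    move=> Mp; rewrite (bigD1 p) //= eqxx mul1r big1 ?addr0 // => n.
    by case/andP=> _ /negPf ->; rewrite mul0r.
  by rewrite sumrB !delta // e subrr.
apply/subsetP=> n Nn; have [m Mm mn] := gdot_surj rM (gdot n).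
suff -> : n = m by [].
have Jg g : gdot (n ^ ltrans g)%g = gdot (m ^ ltrans g)%g.
  have NnJ : (n ^ ltrans g)%g \in N by rewrite ltransJ.
  have [l Ml ln] := gdot_surj rM (gdot (n ^ ltrans g)%g).
  rewrite -ln; congr gdot; apply: sepM => //; first by rewrite ltransJ.
  move=> h; rewrite -[h]fK -(coef _ _ _ NnJ Ml) // (th_fixed imX) (th_fixed imY).
  by congr (_ _); apply: coef.
apply: invg_inj; apply/permP=> x.
by have := Jg (x^-1)%g; rewrite !gdotJ invgK => /mulIg.
Qed.

Lemma hg_iso_eq X Y N M : normalized N -> regular N -> normalized M ->
    regular M -> gp_corresponds X N -> gp_corresponds Y M -> hg_iso X Y ->
  N = M.
Proof.
move=> nN rN nM rM XN YM iso; apply/val_inj/eqP; rewrite eqEcard.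
by rewrite (hg_iso_sub nN rN nM rM XN YM iso) (card_regular rN) (card_regular rM) leqnn.
Qed.

Definition gp_groups (rT : finGroupType) (T : {group rT}) :=
  [set N : {group {perm G}} | [&& regular N, normalized N & N \isog T]].

Lemma num_hopfGalois_gp_groups (rT : finGroupType) (T : {group rT}) :
  num_hopfGalois K T #|gp_groups T|.
Proof.
pose Nth (i : 'I_#|gp_groups T|) : {group {perm G}} := enum_val i.
have gpP i : [&& regular (Nth i), normalized (Nth i) & Nth i \isog T].
  by have := enum_valP i; rewrite inE.
have regi i : regular (Nth i) by case/and3P: (gpP i).
have nori i : normalized (Nth i) by case/and3P: (gpP i).
exists (fun i => gp_structure (nori i) (regi i)); split=> [i|i j iso|X].
- exists (Nth i); split=> //; last by case/and3P: (gpP i).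
  exact: gp_structureP.
- apply: enum_val_inj.
  exact: (hg_iso_eq (nori i) (regi i) (nori j) (regi j)
           (gp_structureP _ _) (gp_structureP _ _)).
- case=> N [rN nN XN TN].
  have SN : N \in gp_groups T by rewrite inE rN nN.
  exists (enum_rank_in SN N).
  apply: (gp_corresponds_iso nN) => //.
  have e : N = Nth (enum_rank_in SN N) by rewrite /Nth enum_rankK_in.
  by rewrite [X in gp_corresponds _ X]e; apply: gp_structureP.
Qed.

End Classification.

(** * Affine cocycles with values in Z/q *)

Section Cocycles.
Variables (gT : finGroupType) (q : nat).
Hypothesis q_gt1 : (1 < q)%N.
Implicit Types pi : {ffun gT -> 'Z_q}.

(** Surjective 1-cocycles for the action of G on Z/q through the factors c, which
    are units by surjectivity ([coc_unit]). The action is left existential, so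
    that pi is the only datum to be counted. *)
Definition cocycles : {set {ffun gT -> 'Z_q}} :=
  [set pi : {ffun gT -> 'Z_q} | [forall g, exists c, forall x, pi (x * g)%g == c * pi x + pi g] &&
            [forall t, exists x, pi x == t]].

Lemma cocyclesP pi :
  reflect ((forall g, exists c, forall x, pi (x * g)%g = c * pi x + pi g) /\
           (forall t, exists x, pi x = t))
          (pi \in cocycles).
Proof.
rewrite inE; apply: (iffP andP) => -[h s]; split.
- move=> g; have /existsP[c /forallP cP] := forallP h g.
  by exists c => x; apply/eqP.
- by move=> t; have /existsP[x /eqP] := forallP s t; exists x.
- apply/forallP=> g; have [c cP] := h g; apply/existsP; exists c.
  by apply/forallP=> x; apply/eqP.
- by apply/forallP=> t; have [x <-] := s t; apply/existsP; exists x.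
Qed.

Lemma coc_surj pi t : pi \in cocycles -> exists x, pi x = t.
Proof. by case/cocyclesP. Qed.

Lemma coc_unit pi g : pi \in cocycles ->
  exists2 c, c \is a GRing.unit & forall x, pi (x * g)%g = c * pi x + pi g.
Proof.
case/cocyclesP=> /(_ g)[c cP] s; exists c => //.
have [y yE] := s (pi g + 1); have := cP (y * g^-1)%g.
rewrite mulgKV yE addrC => /addIr c1.
by apply/unitrP; exists (pi (y * g^-1)%g); rewrite mulrC -c1.
Qed.

Lemma coc1 pi : pi \in cocycles -> pi 1%g = 0.
Proof.
move=> Cp; have [c _ cP] := coc_unit 1%g Cp; have [x x0] := coc_surj 0 Cp.
by have := cP x; rewrite mulg1 x0 mulr0 add0r.
Qed.

(** Right translation by the inverse of y acts by a unit factor, so fibres of pi,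
    also modulo the annihilator of m, are cosets. *)
Lemma coc_eq pi (m : 'Z_q) x y : pi \in cocycles ->
  (m * pi x == m * pi y) = (m * pi (x * y^-1)%g == 0).
Proof.
move=> Cp; have [c cU cP] := coc_unit y Cp.
rewrite -{1}[x](mulgKV y) cP mulrDr -subr_eq0 addrK mulrCA.
by have := inj_eq (mulrI cU) (m * pi (x * y^-1)%g) 0; rewrite mulr0.
Qed.

Lemma coc_eq1 pi x y : pi \in cocycles -> (pi x == pi y) = (pi (x * y^-1)%g == 0).
Proof. by move/(coc_eq 1 x y); rewrite !mul1r. Qed.

(** With m = 1 this is the zero set of pi, and with m = 2 modulo 4 the set where pi
    is even. *)
Definition coc_ker (m : 'Z_q) pi := [set x | m * pi x == 0].

Lemma coc_ker_group_set m pi : pi \in cocycles -> group_set (coc_ker m pi).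
Proof.
move=> Cp; apply/group_setP; split; first by rewrite inE coc1 ?mulr0.
move=> x y; rewrite !inE => /eqP x0 /eqP y0; have [c _ cP] := coc_unit y Cp.
by rewrite cP mulrDr y0 addr0 mulrCA x0 mulr0.
Qed.

Lemma card_coc_preim pi (P : pred 'Z_q) : pi \in cocycles ->
  #|[set x | P (pi x)]| = (#|[set t | P t]| * #|coc_ker 1%R pi|)%N.
Proof.
move=> Cp; rewrite -sum1_card (partition_big pi (mem [set t | P t])) /=; last first.
  by move=> x; rewrite !inE.
rewrite -sum_nat_const; apply: eq_bigr => t; rewrite inE => Pt.
have [y yt] := coc_surj t Cp.
rewrite sum1dep_card -[RHS](card_rcoset _ y); apply: eq_card => x.
rewrite mem_rcoset !inE.
by rewrite mul1r -coc_eq1 // yt; case: eqP => [->|]; rewrite ?Pt ?andbF.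
Qed.

Lemma card_coc_ker1 pi : pi \in cocycles -> #|[set: gT]| = (q * #|coc_ker 1%R pi|)%N.
Proof.
move=> /(card_coc_preim predT).
have -> : [set x : gT | predT (pi x)] = setT by apply/setP=> x; rewrite !inE.
have -> : [set x : 'Z_q | predT x] = setT by apply/setP=> x; rewrite !inE.
by rewrite [#|[set: 'Z_q]|]cardsT card_ord Zp_cast.
Qed.

Lemma coc_scale pi u : u \is a GRing.unit -> pi \in cocycles ->
  [ffun x => u * pi x] \in cocycles.
Proof.
move=> uU /cocyclesP[h s]; apply/cocyclesP; split=> [g|t].
  have [c cP] := h g; exists c => x.
  by rewrite !ffunE cP mulrDr mulrCA.
by have [x xE] := s (u^-1 * t); exists x; rewrite ffunE xE mulVKr.
Qed.

(** Counting principle: if kappa is invariant under units and separates the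
    classes of cocycles up to units, each value is taken phi(q) times. *)
Lemma card_cocycles (T : finType) (kappa : {ffun gT -> 'Z_q} -> T) :
  (forall pi u, pi \in cocycles -> u \is a GRing.unit ->
     kappa [ffun x => u * pi x] = kappa pi) ->
  (forall pi pi', pi \in cocycles -> pi' \in cocycles -> kappa pi = kappa pi' ->
     exists c, forall x, pi' x = c * pi x) ->
  #|cocycles| = (#|kappa @: cocycles| * totient q)%N.
Proof.
move=> kU kE; rewrite -sum1_card (partition_big_imset kappa) /=.
rewrite -sum_nat_const; apply: eq_bigr => y /imsetP[pi Cp ->].
rewrite sum1dep_card -card_units_Zp ?(ltnW q_gt1) // /units_Zp /=.
pose f (u : {unit 'Z_q}) := [ffun x => val u * pi x].
have f_inj : injective f.
  move=> u v /ffunP e; have [x x1] := coc_surj 1 Cp.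
  by apply: val_inj; have := e x; rewrite !ffunE x1 !mulr1.
rewrite -(card_imset _ f_inj); apply: eq_card => pi'; rewrite inE.
apply/andP/imsetP=> [[Cp' /eqP/esym e]|[u _ ->]]; last first.
  by split; [apply: coc_scale (valP u) Cp | rewrite kU // (valP u)].
have [c cP] := kE _ _ Cp Cp' e.
have cU : c \is a GRing.unit.
  have [x x1] := coc_surj 1 Cp'; apply/unitrP; exists (pi x).
  by rewrite mulrC -cP x1.
exists (FinRing.unit 'Z_q cU); first by rewrite inE.
by apply/ffunP=> x; rewrite ffunE.
Qed.

End Cocycles.

(** * Cyclic regular subgroups as cocycles *)

Section CyclicRegular.
Variable gT : finGroupType.
Local Notation n := #|[set: gT]|.
Hypothesis n_gt1 : (1 < n)%N.
Implicit Types (pi : {ffun gT -> 'Z_n}) (N : {group {perm gT}}).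

Definition rtransl (g : gT) : {perm gT} := perm (mulIg g).

Definition cyclic_regular : {set {group {perm gT}}} :=
  [set N : {group {perm gT}} |
    [&& [transitive N, on [set: gT] | 'P] && [forall x : gT, ('C_N[x | 'P] == 1)%g],
        ([set rtransl g | g : gT] \subset 'N(N))%g & cyclic N]].

Lemma rtranslE g x : rtransl g x = (x * g)%g.
Proof. by rewrite permE. Qed.

(** The permutations that become translations of Z/n through pi. *)
Definition shifts pi :=
  [set s : {perm gT} | [exists c, forall x, pi (s x) == pi x + c]].

Lemma shiftsP pi (s : {perm gT}) :
  reflect (exists c, forall x, pi (s x) = pi x + c) (s \in shifts pi).
Proof.
rewrite inE; apply: (iffP existsP) => -[c cP]; exists c.
  by move=> x; apply/eqP/(forallP cP).
by apply/forallP=> x; apply/eqP.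
Qed.

Fact shifts_group_set pi : group_set (shifts pi).
Proof.
apply/group_setP; split=> [|s t /shiftsP[c cP] /shiftsP[d dP]]; apply/shiftsP.
  by exists 0 => x; rewrite perm1 addr0.
by exists (c + d) => x; rewrite permM dP cP addrA.
Qed.
Canonical shifts_group pi := Group (shifts_group_set pi).

Section Bijective.
Variable pi : {ffun gT -> 'Z_n}.
Hypothesis Cpi : pi \in cocycles gT n.

Lemma coc_inj : injective pi.
Proof.
move=> x y /eqP; rewrite coc_eq1 // => e.
have K1 : coc_ker 1%R pi = [set 1%g].
  apply/eqP; rewrite eq_sym eqEcard cards1 sub1set inE coc1 // mulr0 eqxx /=.
  have := card_coc_ker1 n_gt1 Cpi; rewrite -{1}[n]muln1 => /eqP.
  by rewrite eqn_pmul2l ?(ltnW n_gt1) // => /eqP <-.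
have : (x * y^-1)%g \in coc_ker 1%R pi by rewrite inE mul1r.
by rewrite K1 inE -eq_mulgV1 => /eqP.
Qed.

Lemma shift_ex c : exists s : {perm gT}, forall x, pi (s x) = pi x + c.
Proof.
have ex x : exists y, pi y == pi x + c.
  by have [y <-] := coc_surj (pi x + c) Cpi; exists y.
have sP x : pi (xchoose (ex x)) = pi x + c by apply/eqP/(xchooseP (ex x)).
have s_inj : injective (fun x => xchoose (ex x)).
  by move=> x y /(congr1 pi); rewrite !sP => /addIr/coc_inj.
by exists (perm s_inj) => x; rewrite permE.
Qed.

Lemma shift_expg (nu : {perm gT}) c : (forall x, pi (nu x) = pi x + c) ->
  forall i x, pi ((nu ^+ i)%g x) = pi x + c *+ i.
Proof.
move=> nuP; elim=> [|i IHi] x; first by rewrite expg0 perm1 addr0.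
by rewrite expgSr permM nuP IHi mulrSr addrA.
Qed.

Lemma shifts_cyclic_regular : shifts_group pi \in cyclic_regular.
Proof.
rewrite inE; apply/and3P; split.
- apply/andP; split.
    apply/imsetP; exists 1%g; rewrite ?inE //; apply/setP=> y; rewrite inE.
    apply/esym/orbitP; have [s sP] := shift_ex (pi y).
    exists s; first by apply/shiftsP; exists (pi y).
    by change (s 1%g = y); apply: coc_inj; rewrite sP coc1 ?add0r.
  apply/forallP=> x; apply/eqP/trivgP/subsetP=> s /setIP[/shiftsP[c cP]].
  move/astab1P=> /= sx; have := cP x; rewrite -[s x]/(aperm x s) sx.
  rewrite -{1}[pi x]addr0 => /addrI c0; apply/set1P/permP=> y.
  by apply: coc_inj; rewrite cP -c0 addr0 perm1.
- apply/subsetP=> _ /imsetP[g _ ->]; rewrite inE; apply/subsetP=> _ /imsetP[s sN ->].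
  have /shiftsP[c cP] := sN; have [d _ dP] := coc_unit g Cpi.
  apply/shiftsP; exists (d * c) => x.
  rewrite conjgE !permM rtranslE dP cP mulrDr addrAC -dP -rtranslE.
  by rewrite permKV.
- have [nu nuP] := shift_ex 1; apply/cyclicP; exists nu; apply/eqP.
  rewrite eqEsubset cycle_subG; apply/andP; split; last by apply/shiftsP; exists 1.
  apply/subsetP=> s /shiftsP[c cP]; apply/cycleP; exists (c : nat).
  by apply/permP=> x; apply: coc_inj; rewrite cP (shift_expg nuP) natr_Zp.
Qed.

End Bijective.

(** The labelling sends the image of 1 under the i-th power of a generator of N
    to i. *)
Lemma cyclic_regularP N : N \in cyclic_regular ->
  exists2 pi, pi \in cocycles gT n & N = shifts_group pi.
Proof.
rewrite inE => /and3P[/andP[trN /forallP reg] nN /cyclicP[nu defN]].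
have fix1 s x : s \in N -> s x = x -> s = 1%g.
  move=> Ns sx; have /eqP/setP/(_ s) := reg x.
  by rewrite inE Ns /= => e; apply/set1P; rewrite -e; apply/astab1P.
have orb y : exists2 s, s \in N & s 1%g = y.
  have /atransP/(_ 1%g (in_setT _)) o := trN.
  by have: y \in orbit 'P%act N 1%g; [rewrite o inE | case/orbitP=> s; exists s].
have oN : #|N| = n.
  rewrite -(card_orbit_stab 'P%act N 1%g) (eqP (reg _)) cards1 muln1.
  by have /atransP/(_ 1%g (in_setT _)) -> := trN.
have onu : #[nu]%g = n by rewrite -oN defN.
pose h (i : 'Z_n) := (nu ^+ i)%g 1%g.
have hE i : h i%:R = (nu ^+ i)%g 1%g.
  by rewrite /h val_Zp_nat // -onu expg_mod_order.
have h_inj : injective h.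
  move=> i j e; have e1 : (nu ^+ i * nu ^- j)%g = 1%g.
    apply: (fix1 _ 1%g); last by rewrite permM -/(h i) e /h permK.
    by rewrite groupM ?groupV // defN mem_cycle.
  move/eqP: e1; rewrite -eq_mulgV1 eq_expg_mod_order onu => /eqP e1.
  by rewrite -[i]natr_Zp -[j]natr_Zp; apply: val_inj; rewrite /= !val_Zp_nat.
have [f hK fK] : bijective h.
  apply: inj_card_bij h_inj _; rewrite card_ord Zp_cast //.
  by rewrite cardsT.
pose pi := [ffun x => f x].
have piE i : pi ((nu ^+ i)%g 1%g) = i%:R by rewrite ffunE -hE hK.
have gen x : exists i : nat, x = (nu ^+ i)%g 1%g by exists (f x); rewrite -[RHS]/(h (f x)) fK.
have Cpi : pi \in cocycles gT n.
  apply/cocyclesP; split=> [g|t]; last by exists (h t); rewrite ffunE hK.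
  have: (nu ^ rtransl g)%g \in N.
    by rewrite memJ_norm ?(subsetP nN) ?imset_f ?inE // defN cycle_id.
  rewrite defN => /cycleP[c cP]; exists c%:R => x.
  have [[i ->] [j gE]] := (gen x, gen g).
  have -> : ((nu ^+ i)%g 1 * g)%g = (nu ^+ (j + c * i))%g 1%g.
    rewrite -rtranslE -permM conjgC permM conjXg cP rtranslE mul1g gE.
    by rewrite -permM -expgM expgD.
  by rewrite gE !piE natrD natrM addrC.
exists pi => //; apply/val_inj/eqP; rewrite eqEsubset /=; apply/andP; split.
  rewrite defN cycle_subG; apply/shiftsP; exists 1 => x.
  by have [i ->] := gen x; rewrite -permM -expgSr !piE mulrSr.
apply/subsetP=> s /shiftsP[c cP]; rewrite defN; apply/cycleP; exists (c : nat).
have pi_inj := coc_inj Cpi.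
apply/permP=> x; apply: pi_inj; rewrite cP; have [i ->] := gen x.
by rewrite -permM -expgD !piE natrD natr_Zp.
Qed.

Lemma card_cyclic_regular :
  #|cocycles gT n| = (#|cyclic_regular| * totient n)%N.
Proof.
rewrite (card_cocycles n_gt1 (kappa := shifts_group)).
- congr (_ * _)%N; apply: eq_card => N; apply/imsetP/idP => [[pi Cpi ->]|].
    exact: shifts_cyclic_regular.
  by case/cyclic_regularP=> pi; exists pi.
- move=> pi u Cpi uU; apply/val_inj/setP=> s; apply/shiftsP/shiftsP=> -[c cP].
    exists (u^-1 * c) => x; have := cP x; rewrite !ffunE => e.
    by apply: (mulrI uU); rewrite e mulrDr mulVKr.
  by exists (u * c) => x; rewrite !ffunE cP mulrDr.
- move=> pi pi' Cpi Cpi' e; have [nu nuP] := shift_ex Cpi 1.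
  have: nu \in shifts_group pi' by rewrite -e; apply/shiftsP; exists 1.
  case/shiftsP=> c cP; exists c => x.
  have -> : x = (nu ^+ (pi x))%g 1%g.
    by apply: (coc_inj Cpi); rewrite (shift_expg nuP) coc1 // add0r natr_Zp.
  rewrite (shift_expg cP) (shift_expg nuP) !coc1 // !add0r -mulr_natr.
  by rewrite !natr_Zp.
Qed.

End CyclicRegular.

(** * Chinese remainder decomposition of cocycles *)

Section Reduction.
Variables m d : nat.
Hypotheses (m_gt1 : (1 < m)%N) (d_gt1 : (1 < d)%N) (dm : (d %| m)%N).

Definition Zp_red (x : 'Z_m) : 'Z_d := (x : nat)%:R.

Lemma Zp_red_nat i : Zp_red i%:R = i%:R.
Proof.
rewrite /Zp_red val_Zp_nat // -(Zp_nat_mod d_gt1 (i %% m)) modn_dvdm //.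
exact: Zp_nat_mod.
Qed.

Lemma Zp_redD : {morph Zp_red : x y / x + y}.
Proof.
move=> x y; rewrite -[x]natr_Zp -[y]natr_Zp -natrD !Zp_red_nat.
exact: natrD.
Qed.

Lemma Zp_redM : {morph Zp_red : x y / x * y}.
Proof.
move=> x y; rewrite -[x]natr_Zp -[y]natr_Zp -natrM !Zp_red_nat.
exact: natrM.
Qed.

Lemma Zp_red_surj t : exists x, Zp_red x = t.
Proof. by exists (t : nat)%:R; rewrite Zp_red_nat natr_Zp. Qed.

Lemma Zp_red_coc (gT : finGroupType) (pi : {ffun gT -> 'Z_m}) :
  pi \in cocycles gT m -> [ffun x => Zp_red (pi x)] \in cocycles gT d.
Proof.
move=> /cocyclesP[h s]; apply/cocyclesP; split=> [g|t].
  have [c cP] := h g; exists (Zp_red c) => x.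
  by rewrite !ffunE cP Zp_redD Zp_redM.
have [u <-] := Zp_red_surj t; have [x <-] := s u.
by exists x; rewrite ffunE.
Qed.

End Reduction.

Lemma natr_Zp_eq m (m_gt1 : (1 < m)%N) i j :
  (i%:R == j%:R :> 'Z_m) = (i == j %[mod m]).
Proof. by rewrite -val_eqE /= !val_Zp_nat. Qed.

(** Two surjective cocycles of coprime moduli are jointly surjective, because
    their zero sets have coprime indices and hence generate the group as a
    product. *)
Lemma card_cocycles_mul (gT : finGroupType) m1 m2 :
    (1 < m1)%N -> (1 < m2)%N -> coprime m1 m2 ->
  #|cocycles gT (m1 * m2)| = (#|cocycles gT m1| * #|cocycles gT m2|)%N.
Proof.
move=> m1_gt1 m2_gt1 co; set m := (m1 * m2)%N.
have m_gt1 : (1 < m)%N by rewrite (leq_trans m1_gt1) // leq_pmulr // ltnW.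
have d1 : (m1 %| m)%N by apply: dvdn_mulr.
have d2 : (m2 %| m)%N by apply: dvdn_mull.
pose r1 := @Zp_red m m1; pose r2 := @Zp_red m m2.
have r_inj x y : r1 x = r1 y -> r2 x = r2 y -> x = y.
  rewrite /r1 /r2 /Zp_red => /eqP e1 /eqP e2.
  rewrite !natr_Zp_eq // in e1 e2.
  by rewrite -[x]natr_Zp -[y]natr_Zp; apply/eqP; rewrite natr_Zp_eq // chinese_remainder ?e1.
pose comb (a : 'Z_m1) (b : 'Z_m2) : 'Z_m := (chinese m1 m2 a b)%:R.
have r1c a b : r1 (comb a b) = a.
  rewrite /r1 /comb Zp_red_nat // -[RHS]natr_Zp; apply/eqP.
  by rewrite natr_Zp_eq // chinese_modl.
have r2c a b : r2 (comb a b) = b.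
  rewrite /r2 /comb Zp_red_nat // -[RHS]natr_Zp; apply/eqP.
  by rewrite natr_Zp_eq // chinese_modr.
pose Phi (pi : {ffun gT -> 'Z_m}) :=
  ([ffun x => r1 (pi x)] : {ffun gT -> 'Z_m1}, [ffun x => r2 (pi x)] : {ffun gT -> 'Z_m2}).
have Phi_inj : injective Phi.
  move=> pi pi' [/ffunP e1 /ffunP e2]; apply/ffunP=> x.
  by apply: r_inj; [have := e1 x | have := e2 x]; rewrite !ffunE.
rewrite -cardsX -(card_imset _ Phi_inj); apply: eq_card => -[p1 p2].
rewrite inE /=; apply/imsetP/andP=> [[pi Cpi [-> ->]]|[C1 C2]].
  by split; apply: Zp_red_coc.
exists [ffun x => comb (p1 x) (p2 x)]; last first.
  by congr (_, _); apply/ffunP=> x; rewrite !ffunE ?r1c ?r2c.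
apply/cocyclesP; split=> [g|t].
  have [c1 _ c1P] := coc_unit g C1; have [c2 _ c2P] := coc_unit g C2.
  exists (comb c1 c2) => x; rewrite !ffunE c1P c2P.
  apply: r_inj; first by rewrite /r1 Zp_redD // Zp_redM // -/r1 !r1c.
  by rewrite /r2 Zp_redD // Zp_redM // -/r2 !r2c.
pose A1 := Group (coc_ker_group_set 1%R C1); pose A2 := Group (coc_ker_group_set 1%R C2).
have A21 : (A2 * A1)%g = [set: gT].
  apply: coprime_index_mulG; rewrite ?subsetT // -!divgS ?subsetT //.
  rewrite {1}(card_coc_ker1 m2_gt1 C2) (card_coc_ker1 m1_gt1 C1).
  by rewrite !mulnK 1?coprime_sym //; [apply: cardG_gt0 A1 | apply: cardG_gt0 A2].
have [y y1] := coc_surj (r1 t) C1; have [c cU cP] := coc_unit y C2.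
(* Correct y on the left by an element a of the zero set of p1: this changes
   the value of p2 without changing that of p1. *)
have [w w2] := coc_surj (c^-1 * (r2 t - p2 y)) C2.
have: w \in (A2 * A1)%g by rewrite A21 inE.
case/mulsgP=> b a; rewrite !inE !mul1r => /eqP b0 /eqP a0 wE.
have a2 : p2 a = c^-1 * (r2 t - p2 y).
  by have [d _ dP] := coc_unit a C2; rewrite -w2 wE dP b0 mulr0 add0r.
exists (a * y)%g; rewrite ffunE; apply: r_inj.
  by rewrite r1c; have [d _ ->] := coc_unit y C1; rewrite a0 mulr0 add0r.
by rewrite r2c cP a2 mulVKr // subrK.
Qed.

(** * Cocycles modulo 3 and 4 *)

Local Close Scope ring_scope.

Section Index2.
Local Open Scope group_scope.
Variable gT : finGroupType.

Lemma index2_mem (L M : {group gT}) : (#|L| * 2)%N = #|M| -> L \subset M ->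
  {in M &, forall x y, (x * y^-1 \in L) = ((x \in L) == (y \in L))}.
Proof.
move=> oL LM x y Mx My.
have [Ly|nLy] := boolP (y \in L); first by rewrite groupMr ?groupV // eqb_id.
have [Lx|nLx] := boolP (x \in L).
  by rewrite groupMl // groupV (negPf nLy).
by rewrite -mem_rcoset (rcoset_index2 LM) ?inE ?nLx ?nLy // -divgS // -oL mulKn ?cardG_gt0.
Qed.

(** A subgroup of index 2 has odd order, so it is the 2'-core of M; it exists as a
    Hall subgroup. *)
Lemma index2_odd (M : {group gT}) r : solvable M -> odd r -> #|M| = (r * 2)%N ->
  exists2 L : {group gT}, L \subset M /\ #|L| = r
   & forall L' : {group gT}, L' \subset M -> #|L'| = r -> L' = L.
Proof.
move=> solM or oM; have r0 := odd_gt0 or.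
have Hall (L : {group gT}) : (2^'.-Hall(M) L) = (L \subset M) && (#|L| == r).
  rewrite pHallE oM partnM // part_pnat_id -?odd_2'nat //.
  by rewrite [X in (_ * X)%N](_ : _ = 1%N) ?muln1 // part_p'nat.
have [L hL] := Hall_exists 2^' solM; have := hL; rewrite Hall => /andP[LM /eqP oL].
exists L => // L' L'M oL'.
have pc (A : {group gT}) : A \subset M -> #|A| = r -> 'O_2^'(M) = A.
  move=> AM oA; apply: normal_Hall_pcore; first by rewrite Hall AM oA eqxx.
  by apply: index2_normal; rewrite // -divgS // oA oM mulKn.
by apply: group_inj; rewrite -(pc L') // (pc L).
Qed.

End Index2.

Local Open Scope ring_scope.

Section Labellings.
Variables (gT : finGroupType) (q : nat) (m : 'Z_q).
Hypothesis q_gt1 : (1 < q)%N.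
Hypothesis aff : forall s : 'Z_q -> 'Z_q, injective s ->
  (forall t t', m * t = m * t' -> m * s t = m * s t') ->
  exists c, forall t, s t = c * t + s 0.
Implicit Type pi : {ffun gT -> 'Z_q}.

(** The labels f are obtained from the labels pi by a permutation of Z/q that
    respects the blocks defined by m. *)
Lemma label_affine pi (f : gT -> 'Z_q) :
  (forall t, exists x, pi x = t) -> pi 1%g = 0 ->
  (forall x y, (pi x == pi y) = (f x == f y)) ->
  (forall x y, m * pi x = m * pi y -> m * f x = m * f y) ->
  exists c, forall x, f x = c * pi x + f 1%g.
Proof.
move=> surj p1 fE fm.
have ex t : exists x, pi x == t by have [x <-] := surj t; exists x.
pose h t := xchoose (ex t).
have hP t : pi (h t) = t by apply/eqP/(xchooseP (ex t)).
have fh x : f x = f (h (pi x)) by apply/eqP; rewrite -fE hP.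
have [t t'|t t' e|c cP] := @aff (fun t => f (h t)).
- by move=> /eqP; rewrite -fE !hP => /eqP.
- by apply: fm; rewrite !hP.
by exists c => x; rewrite fh cP [in RHS]fh p1.
Qed.

Lemma labelling_cocycle pi (H M : {group gT}) :
  (forall t, exists x, pi x = t) -> pi 1%g = 0 ->
  (forall x y, (pi x == pi y) = (x * y^-1 \in H)%g) ->
  (forall x y, (m * pi x == m * pi y) = (x * y^-1 \in M)%g) ->
  pi \in cocycles gT q.
Proof.
move=> surj p1 hH hM; apply/cocyclesP; split=> // g.
have J x y : ((x * g) * (y * g)^-1)%g = (x * y^-1)%g.
  by rewrite invMg mulgA mulgK.
have [x y|x y /eqP|c cP] := @label_affine pi (fun x => pi (x * g)%g) surj p1.
- by rewrite !hH J.
- by rewrite hM -J -hM => /eqP.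
by exists c => x; rewrite cP mul1g.
Qed.

Lemma cocycle_proportional pi pi' :
  pi \in cocycles gT q -> pi' \in cocycles gT q ->
  coc_ker 1%R pi = coc_ker 1%R pi' -> coc_ker m pi = coc_ker m pi' ->
  exists c, forall x, pi' x = c * pi x.
Proof.
move=> Cp Cp' e1 em.
have [x y|x y /eqP|c cP] := @label_affine pi pi' (fun t => coc_surj t Cp) (coc1 Cp).
- rewrite !coc_eq1 //; have /setP/(_ (x * y^-1)%g) := e1.
  by rewrite !inE !mul1r.
- rewrite coc_eq //; have /setP/(_ (x * y^-1)%g) := em.
  by rewrite !inE => -> h; apply/eqP; rewrite coc_eq.
by exists c => x; rewrite cP coc1 // addr0.
Qed.

Lemma coset_labelling (L : {group gT}) : (#|L| * q)%N = #|[set: gT]| ->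
  exists pi, [/\ forall t, exists x, pi x = t, pi 1%g = 0
    & forall x y, (pi x == pi y) = (x * y^-1 \in L)%g].
Proof.
move=> oL.
have iL : #|rcosets L [set: gT]| = q.
  by rewrite -[LHS]/#|[set: gT] : L|%g -divgS ?subsetT // -oL mulKn ?cardG_gt0.
have Lx x : rcoset L x \in rcosets L [set: gT] by apply: imset_f; rewrite inE.
pose e A : 'Z_q := (index A (enum (rcosets L [set: gT])))%:R.
have e_inj : {in rcosets L [set: gT] &, injective e}.
  move=> A B RA RB /eqP; rewrite natr_Zp_eq // => /eqP.
  have lt C : C \in rcosets L [set: gT] ->
      (index C (enum (rcosets L [set: gT])) < q)%N.
    by rewrite -[X in (_ < X)%N]iL cardE index_mem mem_enum.
  rewrite !modn_small ?lt // => eAB.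
  by rewrite -[A](nth_index set0 (s := enum (rcosets L [set: gT]))) ?mem_enum // eAB nth_index ?mem_enum.
pose f x := e (rcoset L x) - e (rcoset L 1%g).
have fE x y : (f x == f y) = (x * y^-1 \in L)%g.
  rewrite (inj_eq (addIr _)); apply/eqP/idP.
    by move/(e_inj _ _ (Lx x) (Lx y)); rewrite !rcosetE => /rcoset_eqP; rewrite mem_rcoset.
  by rewrite -mem_rcoset => /rcoset_eqP e1; rewrite !rcosetE e1.
exists (finfun f); split=> [t||x y].
- pose g A := e A - e (rcoset L 1%g).
  have: t \in g @: rcosets L [set: gT].
    suff -> : g @: rcosets L [set: gT] = setT by rewrite inE.
    apply/eqP; rewrite eqEcard subsetT card_in_imset.
      by rewrite /= iL cardsT card_ord Zp_cast.
    by move=> A B RA RB /addIr; apply: e_inj.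
  case/imsetP=> A /imsetP[x _ ->] ->; exists x; by rewrite ffunE.
- by rewrite ffunE /f subrr.
- by rewrite !ffunE fE.
Qed.

End Labellings.

Lemma Zp_affine3 (s : 'Z_3 -> 'Z_3) : injective s ->
  (forall t t', 1 * t = 1 * t' -> 1 * s t = 1 * s t') ->
  exists c, forall t, s t = c * t + s 0.
Proof.
move=> sI _; exists (s 1 - s 0).
have brute (a b c : 'Z_3) : [&& a != b, a != c & b != c] ==> (c == (b - a) * 2%:R + a).
  by case: a => [[|[|[|a]]] ia] //; case: b => [[|[|[|b]]] ib] //; case: c => [[|[|[|c]]] ic].
have ne t t' : t != t' -> s t != s t' by rewrite (inj_eq sI).
have := brute (s 0) (s 1) (s 2%:R); rewrite !ne //= => /eqP s2 t.
have : [|| t == 0, t == 1 | t == 2%:R] by case: t => [[|[|[|t]]] it].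
case/or3P=> /eqP->; [by rewrite mulr0 add0r | by rewrite mulr1 subrK | exact: s2].
Qed.

Lemma Zp_affine4 (s : 'Z_4 -> 'Z_4) : injective s ->
  (forall t t', 2%:R * t = 2%:R * t' -> 2%:R * s t = 2%:R * s t') ->
  exists c, forall t, s t = c * t + s 0.
Proof.
move=> sI s2; exists (s 1 - s 0).
have brute (a b c d : 'Z_4) :
    [&& a != b, a != c, a != d, b != d, 2%:R * a == 2%:R * c & 2%:R * b == 2%:R * d]
    ==> (c == (b - a) * 2%:R + a) && (d == (b - a) * 3%:R + a).
  case: a => [[|[|[|[|a]]]] ia] //; case: b => [[|[|[|[|b]]]] ib] //;
  case: c => [[|[|[|[|c]]]] ic] //; by case: d => [[|[|[|[|d]]]] id].
have ne t t' : t != t' -> s t != s t' by rewrite (inj_eq sI).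
have := brute (s 0) (s 1) (s 2%:R) (s 3%:R).
have -> : 2%:R * s 0 = 2%:R * s 2%:R by apply/s2/eqP.
have -> : 2%:R * s 1 = 2%:R * s 3%:R by apply/s2/eqP.
rewrite !ne ?eqxx //= => /andP[/eqP e2 /eqP e3] t.
have : [|| t == 0, t == 1, t == 2%:R | t == 3%:R] by case: t => [[|[|[|[|t]]]] it].
by case/or4P=> /eqP->; [rewrite mulr0 add0r | rewrite mulr1 subrK | |].
Qed.

Section IndexCounts.
Variable gT : finGroupType.

Definition index_groups d := [set L : {group gT} | (#|L| * d == #|[set: gT]|)%N].

Lemma coc_ker_scale q (m u : 'Z_q) (pi : {ffun gT -> 'Z_q}) : u \is a GRing.unit ->
  coc_ker m [ffun x => u * pi x] = coc_ker m pi.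
Proof.
move=> uU; apply/setP=> x; rewrite !inE ffunE mulrCA.
by have := inj_eq (mulrI uU) (m * pi x) 0; rewrite mulr0.
Qed.

(** Any bijection from the cosets of a subgroup of index 3 to Z/3 works, as long as
    the subgroup itself has label 0. *)
Lemma card_cocycles3 : #|cocycles gT 3| = (#|index_groups 3| * 2)%N.
Proof.
rewrite (@card_cocycles gT 3 isT _ (coc_ker 1%R)).
- congr (_ * _)%N; rewrite -(card_imset _ (@group_inj gT)); apply: eq_card => A.
  apply/imsetP/imsetP=> [[pi Cpi ->]|[L]].
    exists (Group (coc_ker_group_set 1%R Cpi)) => //.
    by rewrite inE (card_coc_ker1 _ Cpi) // mulnC.
  rewrite inE => /eqP oL ->; have [|pi [surj p1 piL]] := @coset_labelling gT 3 _ L oL.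
    by [].
  exists pi; last first.
    by apply/setP=> x; rewrite inE mul1r -p1 piL invg1 mulg1.
  by apply: (labelling_cocycle Zp_affine3 surj p1 piL) => x y; rewrite !mul1r piL.
- by move=> pi u _; apply: coc_ker_scale.
- move=> pi pi' Cp Cp' e; exact: (cocycle_proportional Zp_affine3 Cp Cp' e e).
Qed.

(** The subgroup M where pi is even determines the zero set of pi, which is the
    unique subgroup of index 2 in M. Conversely, labelling the cosets of that
    subgroup so that M gets the labels 0 and 2 gives a cocycle. *)
Lemma card_cocycles4 r : solvable [set: gT] -> odd r -> #|[set: gT]| = (r * 4)%N ->
  #|cocycles gT 4| = (#|index_groups 2| * 2)%N.
Proof.
move=> solG or oG; have r0 := odd_gt0 or.
rewrite (@card_cocycles gT 4 isT _ (coc_ker 2%:R)).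
- congr (_ * _)%N; rewrite -(card_imset _ (@group_inj gT)); apply: eq_card => A.
  apply/imsetP/imsetP=> [[pi Cpi ->]|[M]].
    exists (Group (coc_ker_group_set 2%:R Cpi)) => //.
    rewrite inE (card_coc_preim [pred t | 2%:R * t == 0] Cpi) (card_coc_ker1 _ Cpi) //.
    suff -> : #|[set t : 'Z_4 | 2%:R * t == 0]| = 2 by rewrite mulnAC.
    suff -> : [set t : 'Z_4 | 2%:R * t == 0] = [set 0; 2%:R] by rewrite cards2.
    by apply/setP=> t; rewrite !inE; case: t => [[|[|[|[|t]]]] it].
  rewrite inE => /eqP oM ->.
  have oM2 : #|M| = (r * 2)%N.
    by apply/eqP; rewrite -(eqn_pmul2r (isT : 0 < 2)%N) oM oG -mulnA.
  have [L [LM oL] _] := index2_odd (solvableS (subsetT M) solG) or oM2.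
  have iL : (#|L| * 4)%N = #|[set: gT]| by rewrite oL oG.
  have [|rho [surj p1 rhoL]] := @coset_labelling gT 4 _ L iL; first by [].
  have nLM : ~~ (M \subset L).
    by apply: contraTN isT => /subset_leq_card; rewrite oL oM2 -{2}[r]muln1 leq_pmul2l.
  have [x Mx nLx] := subsetPn nLM.
  have rho0 y : (rho y == 0) = (y \in L) by rewrite -p1 rhoL invg1 mulg1.
  pose a := rho x; have a0 : a != 0 by rewrite rho0.
  (* A transposition makes 2 the label of the coset of x, so that M, the union of
     this coset and L, becomes the set of even labels. *)
  pose s := tperm a (2%:R : 'Z_4).
  have s0 : s 0 = 0 by rewrite tpermD // eq_sym.
  pose pi : {ffun gT -> 'Z_4} := [ffun y => s (rho y)].
  have piL y z : (pi y == pi z) = (y * z^-1 \in L)%g.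
    by rewrite !ffunE (inj_eq perm_inj) rhoL.
  have pi1 : pi 1%g = 0 by rewrite ffunE p1.
  have pix : pi x = 2%:R by rewrite ffunE tpermL.
  have piM y : (y \in M) = (2%:R * pi y == 0).
    have -> : (2%:R * pi y == 0) = ((pi y == pi 1%g) || (pi y == pi x)).
      by rewrite pi1 pix; case: (pi y) => [[|[|[|[|t]]]] it].
    rewrite !piL invg1 mulg1; apply/idP/orP => [My|[Ly|Ly]].
    - have [Ly|nLy] := boolP (y \in L); [by left | right].
      have oLM : (#|L| * 2)%N = #|M| by rewrite oL.
      by rewrite (index2_mem oLM LM) // (negPf nLy) (negPf nLx).
    - exact: (subsetP LM).
    - by rewrite -[y](mulgKV x) groupM // (subsetP LM).
  have surj' t : exists y, pi y = t.
    by have [y yE] := surj (s t); exists y; rewrite ffunE yE tpermK.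
  have TM : (#|M| * 2)%N = #|[set: gT]| by rewrite oM.
  exists pi; last by apply/setP=> y; rewrite inE piM.
  apply: (labelling_cocycle Zp_affine4 surj' pi1 piL (M := M)) => y z.
  rewrite (index2_mem TM (subsetT M)) ?inE // !piM.
  by case: (pi y) => [[|[|[|[|t]]]] it] //; case: (pi z) => [[|[|[|[|u]]]] iu].
- by move=> pi u _; apply: coc_ker_scale.
- move=> pi pi' Cp Cp' e; apply: (cocycle_proportional Zp_affine4 Cp Cp' _ e).
  pose A := Group (coc_ker_group_set 1%R Cp); pose A' := Group (coc_ker_group_set 1%R Cp').
  pose M := Group (coc_ker_group_set 2%:R Cp).
  have o1 (f : {ffun gT -> 'Z_4}) : f \in cocycles gT 4 -> #|coc_ker 1%R f| = r.
    move=> Cf; apply/eqP; have := card_coc_ker1 (isT : (1 < 4)%N) Cf; rewrite oG mulnC => /eqP.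
    by rewrite eqn_pmul2l // eq_sym.
  have sub (f : {ffun gT -> 'Z_4}) : coc_ker 1%R f \subset coc_ker 2%:R f.
    by apply/subsetP=> y; rewrite !inE mul1r => /eqP->; rewrite mulr0.
  have oM : #|M| = (r * 2)%N.
    rewrite (card_coc_preim [pred t | 2%:R * t == 0] Cp) (o1 _ Cp) mulnC; congr (_ * _)%N.
    suff -> : [set t : 'Z_4 | 2%:R * t == 0] = [set 0; 2%:R] by rewrite cards2.
    by apply/setP=> t; rewrite !inE; case: t => [[|[|[|[|t]]]] it].
  have [L _ uniqL] := index2_odd (solvableS (subsetT M) solG) or oM.
  have AL : A = L by apply: uniqL; [apply: sub | apply: o1].
  have A'L : A' = L by apply: uniqL; [rewrite /= e; apply: sub | apply: o1].
  by have := congr1 (@gval gT) (etrans AL (esym A'L)).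
Qed.

End IndexCounts.

(** * Cocycles modulo a prime with a normal Sylow subgroup *)

Section NormalPrime.
Variables (gT : finGroupType) (p h : nat) (P : {group gT}).
Hypotheses (p_pr : prime p) (cop : coprime h p) (oG : #|[set: gT]| = (h * p)%N).
Hypotheses (nP : (P <| [set: gT])%g) (oP : #|P| = p).

Let p_gt1 : (1 < p)%N := prime_gt1 p_pr.

Lemma unit_Zp_expp (c : 'Z_p) : c \is a GRing.unit -> c ^+ p = c.
Proof.
move=> cU; pose u := FinRing.unit 'Z_p cU.
have /(congr1 val) : (u ^+ p.-1 = 1)%g.
  rewrite -totient_prime // -(card_units_Zp (prime_gt0 p_pr)).
  by apply: expg_cardG; rewrite inE.
rewrite FinRing.val_unitX /= => c1.
by rewrite -[X in c ^+ X](prednK (prime_gt0 p_pr)) exprS c1 mulr1.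
Qed.

(** The factor c attached to z satisfies c ^ p = 1, as z has order p, and also
    c ^ (p - 1) = 1; hence c = 1. *)
Lemma coc_additive (pi : {ffun gT -> 'Z_p}) z : pi \in cocycles gT p -> z \in P ->
  forall x, pi (x * z)%g = pi x + pi z.
Proof.
move=> Cp Pz; have [c cU cP] := coc_unit z Cp.
have cX i x : pi (x * z ^+ i)%g = c ^+ i * pi x + pi (z ^+ i)%g.
  elim: i x => [|i IHi] x; first by rewrite expg0 mulg1 coc1 // mul1r addr0.
  by rewrite expgSr mulgA !cP IHi exprS mulrDr mulrA addrA.
have [x x1] := coc_surj 1 Cp.
have c1 : c = 1.
  have := cX p x; have -> : (z ^+ p = 1)%g by rewrite -oP expg_cardG.
  by rewrite mulg1 coc1 // addr0 x1 mulr1 unit_Zp_expp.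
by move=> y; rewrite cP c1 mul1r.
Qed.

Lemma prime_factor (A : {group gT}) z : #|A| = h -> P :=: <[z]>%g ->
  forall x, exists2 a, a \in A & exists i, x = (a * z ^+ i)%g.
Proof.
move=> oA defP x; have : x \in (A * P)%g.
  suff -> : (A * P)%g = [set: gT] by rewrite inE.
  by apply/eqP; rewrite eqEcard subsetT oG coprime_cardMg ?oA ?oP /=.
case/mulsgP=> a y Aa; rewrite defP => /cycleP[i ->] ->.
by exists a => //; exists i.
Qed.

(** A cocycle is determined by its zero set A and by its value at a generator z of
    P, since it sends a z^i to i times this value. Conversely, for a complement A
    of P, the exponent i of z in the factorization a z^i is a cocycle, as A
    acts on P by powers. *)
Lemma card_cocycles_prime : #|cocycles gT p| = (#|index_groups gT p| * p.-1)%N.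
Proof.
have /cyclicP[z defP] : cyclic P by rewrite prime_cyclic ?oP.
have Pz : z \in P by rewrite defP cycle_id.
have h0 : (0 < h)%N by move: (cardG_gt0 [set: gT]); rewrite oG; case: (h).
have oz : #[z]%g = p by rewrite -oP defP.
rewrite (@card_cocycles gT p p_gt1 _ (coc_ker 1%R)) ?totient_prime //.
- congr (_ * _)%N; rewrite -(card_imset _ (@group_inj gT)); apply: eq_card => B.
  apply/imsetP/imsetP=> [[pi Cpi ->]|[A]].
    exists (Group (coc_ker_group_set 1%R Cpi)) => //.
    by rewrite inE (card_coc_ker1 _ Cpi) // mulnC.
  rewrite inE => /eqP; rewrite oG => /eqP; rewrite eqn_pmul2r ?prime_gt0 // => /eqP oA ->.
  have fact := prime_factor oA defP.
  have tiAP : A :&: P = 1%g by apply: coprime_TIg; rewrite oA oP.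
  have ex x : exists i : 'Z_p, (x * z ^- i)%g \in A.
    have [a Aa [i ->]] := fact x; exists i%:R.
    by rewrite val_Zp_nat // -[X in (_ %% X)%N]oz expg_mod_order mulgK.
  pose pi := [ffun x => xchoose (ex x)].
  have piE a i : a \in A -> pi (a * z ^+ i)%g = i%:R.
    move=> Aa; rewrite ffunE; have := xchooseP (ex (a * z ^+ i)%g).
    move: (xchoose _) => j; rewrite -mulgA groupMl // => Aij.
    have : (z ^+ i * z ^- j)%g \in A :&: P.
      by rewrite inE Aij groupM ?groupV ?groupX.
    rewrite tiAP inE -eq_mulgV1 eq_expg_mod_order oz -natr_Zp_eq // natr_Zp => /eqP.
    by [].
  exists pi; last first.
    apply/setP=> x; have [a Aa [i ->]] := fact x; rewrite inE mul1r piE // groupMl //.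
    apply/idP/eqP => [Az|].
      have : (z ^+ i)%g \in A :&: P by rewrite inE Az groupX.
      rewrite tiAP inE -[1%g](expg0 z) eq_expg_mod_order oz -natr_Zp_eq // => /eqP.
      by [].
    move/eqP; rewrite -[0](mulr0n 1) natr_Zp_eq // -oz -eq_expg_mod_order => /eqP->.
    by rewrite group1.
  apply/cocyclesP; split=> [g|t]; last first.
    by exists (1 * z ^+ t)%g; rewrite piE // natr_Zp.
  have [a Aa [j ->]] := fact g.
  have: (z ^ a)%g \in P by rewrite memJ_norm // (subsetP (normal_norm nP)) ?inE.
  rewrite {1}defP => /cycleP[c cP]; exists c%:R => x.
  have [b Ab [i ->]] := fact x.
  have -> : (b * z ^+ i * (a * z ^+ j) = (b * a) * z ^+ (c * i + j))%g.
    by rewrite expgD expgM -cP -conjXg !mulgA -(mulgA b) (conjgC (z ^+ i)) !mulgA.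
  by rewrite !piE ?groupM // natrD natrM.
- by move=> pi u _; apply: coc_ker_scale.
- move=> pi pi' Cp Cp' e; pose A := Group (coc_ker_group_set 1%R Cp).
  have oA : #|A| = h.
    apply/eqP; have := card_coc_ker1 p_gt1 Cp; rewrite oG mulnC => /eqP.
    by rewrite eqn_pmul2l ?prime_gt0 // eq_sym.
  have fact := prime_factor oA defP.
  have ev (f : {ffun gT -> 'Z_p}) a i : f \in cocycles gT p -> a \in coc_ker 1%R f ->
      f (a * z ^+ i)%g = i%:R * f z.
    move=> Cf; rewrite inE mul1r => /eqP a0.
    elim: i => [|i IHi]; first by rewrite mulg1 a0 mul0r.
    by rewrite expgSr mulgA (coc_additive Cf) // IHi -natr1 mulrDl mul1r.
  have zU : pi z \is a GRing.unit.
    have [x x1] := coc_surj 1 Cp; have [a Aa [i xE]] := fact x.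
    apply/unitrP; exists i%:R; rewrite [pi z * _]mulrC.
    by rewrite -(ev pi a i Cp Aa) -xE x1.
  exists (pi' z / pi z) => x; have [a Aa [i ->]] := fact x.
  have Aa' : a \in coc_ker 1%R pi' by rewrite -e.
  by rewrite !ev // mulrCA divrK.
Qed.

End NormalPrime.

Local Close Scope ring_scope.
Local Open Scope group_scope.

(** * Counting subgroups of a given index *)

Definition index_subgroups (gT : finGroupType) (G : {group gT}) d :=
  [set L : {group gT} | (L \subset G) && (#|L| * d == #|G|)%N].

Lemma index_groups_setT gT d : index_groups gT d = index_subgroups [set: gT] d.
Proof. by apply/setP=> L; rewrite !inE subsetT. Qed.

Lemma card_cyclic_regular_12p (gT : finGroupType) p (P : {group gT}) :
    prime p -> 4 < p -> #|[set: gT]| = (12 * p)%N -> P <| [set: gT] -> #|P| = p ->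
  #|cyclic_regular gT| =
    (#|index_subgroups [set: gT] 2| * #|index_subgroups [set: gT] 3| *
     #|index_subgroups [set: gT] p|)%N.
Proof.
move=> p_pr p_gt4 oG nP oP.
have cop d : d < 5 -> d > 0 -> coprime d p.
  move=> d5 d0; rewrite coprime_sym prime_coprime //; apply/negP=> /(dvdn_leq d0).
  by rewrite leqNgt (leq_trans d5).
have cop4 := cop 4 isT isT; have cop3 := cop 3 isT isT.
have cop12 : coprime 12 p by rewrite -[12]/(4 * 3)%N coprimeMl cop4 cop3.
have p_odd : odd p by rewrite -coprimen2 coprime_sym cop.
have solG : solvable [set: gT].
  rewrite (series_sol nP); apply/andP; split.
    by apply: abelian_sol; rewrite cyclic_abelian ?prime_cyclic ?oP.
  apply: Burnside_p_a_q_b; rewrite card_quotient ?(normal_norm nP) //.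
  by rewrite -divgS ?(normal_sub nP) // oG oP mulnK ?prime_gt0.
have p_gt1 := prime_gt1 p_pr; have p_gt0 := prime_gt0 p_pr.
have := card_cyclic_regular (gT := gT).
rewrite oG => /(_ (leq_trans p_gt1 (leq_pmull p (isT : 0 < 12)))).
have e12 : #|cocycles gT 12| = (#|cocycles gT 4| * #|cocycles gT 3|)%N.
  exact: (@card_cocycles_mul gT 4 3).
rewrite (@card_cocycles_mul gT 12 p) // e12.
rewrite (card_cocycles4 (r := 3 * p) solG) ?oddM //; last by rewrite oG mulnAC.
rewrite card_cocycles3 (card_cocycles_prime p_pr cop12 oG nP oP).
rewrite totient_coprime // (totient_prime p_pr) !index_groups_setT => e.
apply/eqP; rewrite -(eqn_pmul2r (_ : 0 < totient 12 * p.-1)); last first.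
  by rewrite muln_gt0 totient_gt0 -subn1 subn_gt0.
apply/eqP; rewrite -e -[totient 12]/(2 * 2)%N [RHS]mulnACA.
by congr (_ * _)%N; rewrite mulnACA.
Qed.

Lemma index_subgroups_isog (gT rT : finGroupType) (G : {group gT}) (H : {group rT}) d :
  G \isog H -> #|index_subgroups G d| = #|index_subgroups H d|.
Proof.
case/isogP=> f injf defH.
pose F (L : {group gT}) := (f @* L)%G.
(* Direct images under f match the subgroups of G with those of H. *)
rewrite -(card_in_imset (f := F) (D := index_subgroups G d)); last first.
  move=> L M; rewrite !inE => /andP[LG _] /andP[MG _] /(congr1 val) /= e.
  by apply: group_inj; apply: injm_morphim_inj e.
apply: eq_card => M; apply/imsetP/idP => [[L]|].
  by rewrite !inE => /andP[LG oL] ->; rewrite -defH morphimS //= !card_injm.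
rewrite inE -defH => /andP[MG oM]; exists (f @*^-1 M)%G; last first.
  by apply: group_inj; rewrite /= morphpreK.
rewrite inE subsetIl /= -(card_injm injf) ?subsetIl // morphpreK //.
by rewrite -(card_injm injf (subxx G)).
Qed.

(** Otherwise L and P would generate a subgroup of order |L| |P|, and |P| would
    divide the index d of L. *)
Lemma normal_prime_sub (gT : finGroupType) (G P L : {group gT}) d :
    P <| G -> prime #|P| -> ~~ (#|P| %| d) -> L \in index_subgroups G d ->
  P \subset L.
Proof.
move=> nP pP pd; rewrite inE => /andP[LG /eqP oL]; apply: contraR pd => nPL.
have /cardSg : L <*> P \subset G by rewrite join_subG LG normal_sub.
have nPL' : L \subset 'N(P) by apply: subset_trans LG (normal_norm nP).
rewrite /= norm_joinEl // TI_cardMg; last by rewrite setIC prime_TIg.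
by rewrite -oL dvdn_pmul2l ?cardG_gt0.
Qed.

Lemma index_subgroups_quotient (gT : finGroupType) (G P : {group gT}) d :
    P <| G -> prime #|P| -> ~~ (#|P| %| d) ->
  #|index_subgroups G d| = #|index_subgroups (G / P) d|.
Proof.
move=> nP pP pd.
have nPG := normal_norm nP; have PG := normal_sub nP.
have sub L : L \in index_subgroups G d -> (P <| L) && (L \subset G).
  move=> iL; have PL := normal_prime_sub nP pP pd iL.
  move: iL; rewrite inE => /andP[LG _]; rewrite LG andbT.
  exact: normalS PL LG nP.
rewrite -(card_in_imset (f := fun L : {group gT} => (L / P)%G)
  (D := index_subgroups G d)); last first.
  move=> L M iL iM /(congr1 val) /= e; apply: group_inj.
  have /andP[PL _] := sub L iL; have /andP[PM _] := sub M iM.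
  by rewrite (quotient_injG _ _ e).
have oq (L : {group gT}) : P <| L -> (#|L / P| * #|P|)%N = #|L|.
  by move=> nL; rewrite -divg_normal // divnK // cardSg ?normal_sub.
apply: eq_card => M; apply/imsetP/idP => [[L iL ->]|].
  have /andP[PL LG] := sub L iL; move: iL; rewrite !inE => /andP[_ oL].
  rewrite quotientS //= -(eqn_pmul2r (cardG_gt0 P)) oq //.
  by rewrite mulnAC oq.
rewrite inE => /andP[MG oM]; have [L defM PL LG] := inv_quotientS nP MG.
have nL := normalS PL LG nP.
exists L; last by apply: group_inj.
by rewrite inE LG /= -(oq L) // -(oq G) // mulnAC eqn_pmul2r ?cardG_gt0 // -defM.
Qed.

(** The subgroups of index p are the complements of P, all conjugate to H by
    Schur-Zassenhaus. Their number divides p, and it is 1 when H is normal, that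
    is, when H centralizes P. *)
Lemma card_complements (gT : finGroupType) (G P H : {group gT}) p :
    P ><| H = G -> prime p -> #|P| = p -> coprime p #|H| ->
  #|index_subgroups G p| = (if H \subset 'C(P) then 1 else p)%N.
Proof.
move=> defG p_pr oP cop.
have [nP HG defPH nPH tiPH] := sdprod_context defG.
have oG : (#|P| * #|H|)%N = #|G| := sdprod_card defG.
have p0 := prime_gt0 p_pr.
have -> : #|index_subgroups G p| = #|H :^: G|.
  rewrite -(card_imset _ (@group_inj gT)); apply: eq_card => A.
  apply/imsetP/imsetP=> [[L]|[x Gx ->]]; last first.
    exists (H :^ x)%G; rewrite // inE cardJg -{1}(conjGid Gx) conjSg HG /=.
    by rewrite -oG oP mulnC.
  rewrite inE -oG oP mulnC eqn_pmul2l // => /andP[LG /eqP oL] ->.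
  have solP : solvable P by rewrite abelian_sol // cyclic_abelian // prime_cyclic // oP.
  have LPH : L \subset P * H by rewrite defPH.
  have coPH : coprime #|P| #|H| by rewrite oP.
  have [x Px e] := SchurZassenhaus_trans_sol solP nPH LPH coPH oL.
  by exists x => //; rewrite (subsetP (normal_sub nP)).
rewrite card_conjugates.
have [cHP|ncHP] := boolP (H \subset 'C(P)).
  apply/eqP; rewrite indexg_eq1 subsetI subxx /= -defPH mulG_subG normG andbT.
  by rewrite cents_norm // centsC.
have /primeP[_ /(_ #|G : 'N_G(H)|)] := p_pr.
have -> : #|G : 'N_G(H)| %| p.
  have iH : #|G : H| = p by rewrite -divgS // -oG oP mulnK ?cardG_gt0.
  by rewrite -iH indexgS // subsetI HG normG.
case/(_ isT)/orP=> /eqP // /eqP.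
rewrite indexg_eq1 subsetI subxx /= => nGH; case/negP: ncHP.
apply/commG1P/trivgP; rewrite -tiPH subsetI.
rewrite commg_subr nPH commg_subl; exact: subset_trans (normal_sub nP) nGH.
Qed.

Section Semidirect.
Variables (p : nat) (fT : finGroupType) (F : {group fT}).
Variable tau : {morphism F >-> {unit 'Z_p}}.
Hypotheses (p_pr : prime p) (cop : coprime p #|F|).
Let to := tau_groupAction tau.
Let P := (sdpair1 to @* [set: 'Z_p])%G.
Let H := (sdpair2 to @* F)%G.

Lemma semidirectE : P ><| H = [set: semidirect tau].
Proof. exact: sdprod_sdpair. Qed.

Lemma card_kernel_part : #|P| = p.
Proof.
by rewrite card_injm ?injm_sdpair1 // cardsT card_ord Zp_cast // prime_gt1.
Qed.

Lemma card_semidirect : #|[set: semidirect tau]| = (p * #|F|)%N.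
Proof.
by rewrite -(sdprod_card semidirectE) card_kernel_part card_injm ?injm_sdpair2.
Qed.

Lemma kernel_part_normal : P <| [set: semidirect tau].
Proof. by case/sdprod_context: semidirectE. Qed.

Lemma centralises_ker : (H \subset 'C(P)) = ('ker tau == F).
Proof.
have actE x (a : 'Z_p) : x \in F -> (sdpair1 to a ^ sdpair2 to x == sdpair1 to a)
    = (tau_act tau a x == a).
  move=> Fx; rewrite -sdpair_act ?inE //.
  by apply: (inj_in_eq (injmP (injm_sdpair1 to))); rewrite inE.
have actE1 x : (tau_act tau 1%R x == 1%R) = (tau x == 1).
  by rewrite /tau_act mulr1 -[1%R]/(val (1 : {unit 'Z_p})) (inj_eq val_inj) eq_invg1.
apply/centsP/eqP=> [cHP|kF].
  apply/eqP; rewrite eqEsubset subsetIl; apply/subsetP=> x Fx; apply/kerP => //.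
  apply/eqP; rewrite -actE1 -actE //; apply/eqP/conjg_fixP/commgP.
  by apply/commute_sym/cHP; rewrite mem_morphim ?inE.
move=> _ /morphimP[x Fx _ ->] _ /morphimP[a _ _ ->].
apply/commute_sym/commgP/conjg_fixP/eqP; rewrite actE // /tau_act.
have /kerP-> // : x \in 'ker tau by rewrite kF.
by rewrite invg1 mul1r.
Qed.

Lemma card_index_semidirect d : ~~ (p %| d) ->
  #|index_subgroups [set: semidirect tau] d| = #|index_subgroups F d|.
Proof.
move=> pd; rewrite (index_subgroups_quotient kernel_part_normal) ?card_kernel_part //.
rewrite -(index_subgroups_isog _ (sdprod_isog semidirectE)).
apply/esym/index_subgroups_isog; apply: sub_isog => //; exact: injm_sdpair2.
Qed.

Lemma card_index_semidirect_p :
  #|index_subgroups [set: semidirect tau] p| = (if 'ker tau == F then 1 else p)%N.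
Proof.
rewrite (card_complements semidirectE p_pr card_kernel_part) ?centralises_ker //.
by rewrite card_injm ?injm_sdpair2.
Qed.

End Semidirect.

(** * Groups of order 12 *)

Lemma cyclic_Zp n : cyclic (Zp n).
Proof. by rewrite /Zp; case: ifP => _; rewrite ?cyclic1 // Zp_cycle cycle_cyclic. Qed.

Section SmallGroups.
Variable gT : finGroupType.
Implicit Types F K M S T Q : {group gT}.

Lemma cyclic_isog_Zp K n : 0 < n -> cyclic K -> #|K| = n -> K \isog Zp n.
Proof.
move=> n0 cK oK; by rewrite isog_cyclic_card // oK card_Zp // eqxx andbT cyclic_Zp.
Qed.

Lemma card4_abelem Q : #|Q| = 4 -> ~~ cyclic Q -> 2.-abelem Q.
Proof.
move=> oQ ncQ; rewrite /abelem (card_p2group_abelian (p := 2)) // /pgroup oQ /=.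
apply/exponentP=> x Qx; apply/eqP; rewrite -order_dvdn.
have : #[x] %| 4 by rewrite -oQ order_dvdG.
have : #[x] != 4.
  apply: contra ncQ => /eqP ox; apply/cyclicP; exists x; apply/eqP.
  by rewrite eq_sym eqEcard cycle_subG Qx oQ -ox leqnn.
by case: #[x] => [|[|[|[|[|n]]]]] //= _ /dvdn_leq.
Qed.

Lemma isog_Klein K : #|K| = 4 -> ~~ cyclic K -> K \isog setX (Zp 2) (Zp 2).
Proof.
move=> oK ncK; rewrite (isog_abelem_card _ (card4_abelem oK ncK)).
rewrite cardsX !card_Zp // oK eqxx andbT /abelem /pgroup cardsX !card_Zp //=.
apply/andP; split.
  apply/centsP=> -[a b] _ [c d] _; congr (_, _); exact: addrC.
apply/exponentP=> -[a b] _; apply/eqP.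
by case: a => [[|[|a]] ia] //; case: b => [[|[|b]] ib].
Qed.

(** Subgroups of index 2 are generated by involutions, of which there are 1 or 3. *)
Lemma card_index2_order4 Q : #|Q| = 4 ->
  #|index_subgroups Q 2| = (if cyclic Q then 1 else 3)%N.
Proof.
move=> oQ.
have idx (L : {group gT}) : (L \in index_subgroups Q 2) = (L \subset Q) && (#|L| == 2).
  by rewrite inE oQ -[4]/(2 * 2)%N eqn_pmul2r.
have [cQ|ncQ] := boolP (cyclic Q).
  have [x Qx ox] : {x | x \in Q & #[x] = 2} by apply: Cauchy; rewrite ?oQ.
  rewrite -[RHS](cards1 <[x]>%G); apply: eq_card => L; rewrite idx inE.
  apply/andP/eqP=> [[LQ oL]|->]; last by rewrite cycle_subG Qx -orderE ox.
  apply: group_inj; apply/eqP.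
  by rewrite (eq_subG_cyclic cQ) ?cycle_subG // -orderE ox.
have abQ := card4_abelem oQ ncQ.
have oQ1 : #|Q^#| = 3 by have := cardsD1 1 Q; rewrite group1 oQ => -[].
rewrite -[RHS]oQ1 -[RHS](card_in_imset (f := fun x => <[x]>%G) (D := Q^#)); last first.
  move=> x y /setD1P[x1 Qx] /setD1P[y1 Qy] /(congr1 val) /= e.
  have : x \in <[y]> by rewrite -e cycle_id.
  by rewrite cycle2g ?(abelem_order_p abQ) // !inE (negPf x1) => /eqP.
apply: eq_card => L; rewrite idx; apply/andP/imsetP=> [[LQ /eqP oL]|[x /setD1P[x1 Qx] ->]].
  have /cyclicP[x defL] : cyclic L by rewrite prime_cyclic ?oL.
  exists x; last exact: group_inj.
  rewrite !inE (subsetP LQ) ?defL ?cycle_id // andbT -cycle_eq1 -defL.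
  by apply: contra_eq_neq oL => ->; rewrite cards1.
by rewrite cycle_subG Qx -orderE (abelem_order_p abQ).
Qed.

Lemma exponent6_noncyclic4 Q : #|Q| = 4 -> exponent Q %| 6 -> ~~ cyclic Q.
Proof. by move=> oQ; apply: contraL => /exponent_cyclic->; rewrite oQ. Qed.

Lemma card6_cyclic K : #|K| = 6 -> abelian K -> cyclic K.
Proof.
move=> oK abK.
have [a Ka oa] : {x | x \in K & #[x] = 3} by apply: Cauchy; rewrite ?oK.
have [b Kb ob] : {x | x \in K & #[x] = 2} by apply: Cauchy; rewrite ?oK.
apply/cyclicP; exists (a * b); apply/eqP; rewrite eq_sym eqEcard cycle_subG groupM //.
by rewrite oK -orderE orderM ?oa ?ob //; apply: (centsP abK).
Qed.

Lemma card6_cases K : #|K| = 6 -> cyclic K \/ K \isog 'D_6.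
Proof.
move=> oK.
have [a Ka oa] : {x | x \in K & #[x] = 3} by apply: Cauchy; rewrite ?oK.
have [b Kb ob] : {x | x \in K & #[x] = 2} by apply: Cauchy; rewrite ?oK.
have aK : <[a]> \subset K by rewrite cycle_subG.
have nA : <[a]> <| K by apply: index2_normal; rewrite // -divgS // oK -orderE oa.
have nAb : b \in 'N(<[a]>) := subsetP (normal_norm nA) b Kb.
have defK : <[a]> <*> <[b]> = K.
  apply/eqP; rewrite eqEcard join_subG aK cycle_subG Kb /= norm_joinEr ?cycle_subG //.
  by rewrite coprime_cardMg -?orderE ?oa ?ob ?oK.
have [cab|ncab] := eqVneq (a ^ b) a.
  left; apply: card6_cyclic => //; rewrite -defK abelianY !cycle_abelian /=.
  rewrite cycle_subG /= cent_cycle; apply/cent1P; apply: commute_sym.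
  by apply/commgP/conjg_fixP.
right.
have G6 : 'D_6 \isog Grp (x : y : x ^+ 3, y ^+ 2, x ^ y = x^-1).
  exact: (@Grp_dihedral 3 isT).
have o6 : #|'D_6| = 6 := @card_dihedral 3 isT.
apply/(isoGrpP _ G6); split; first by rewrite /= oK o6.
apply/existsP; exists (a, b); rewrite /= !xpair_eqE /= defK eqxx /=.
rewrite -{1}oa expg_order eqxx -{1}ob expg_order eqxx /=.
have : a ^ b \in <[a]> by rewrite memJ_norm // cycle_id.
case/cyclePmin=> -[|[|[|i]]]; rewrite oa // => _.
- by move=> e; have := oa; rewrite -(orderJ a b) e order1.
- by move=> e; rewrite e expg1 eqxx in ncab.
- by move=> ->; rewrite eq_sym eq_invg_mul -expgS -oa expg_order.
Qed.

End SmallGroups.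

Section Order12.
Variables (gT : finGroupType) (F : {group gT}).
Hypothesis oF : #|F| = 12.
Implicit Types K M S T : {group gT}.

Lemma order12_Sylow : exists2 S : {group gT}, S \subset F & #|S| = 4.
Proof.
have [S sylS] := Sylow_exists 2 F; exists S; first exact: pHall_sub sylS.
by rewrite (card_Hall sylS) oF p_part.
Qed.

Section NormalSylow3.
Variable T : {group gT}.
Hypotheses (nT : T <| F) (oT : #|T| = 3).

Lemma order12_sdprod S : S \subset F -> #|S| = 4 -> T ><| S = F.
Proof.
move=> SF oS; have nTS := subset_trans SF (normal_norm nT).
have tiTS : T :&: S = 1 by apply: coprime_TIg; rewrite oT oS.
rewrite sdprodE //; apply/eqP; rewrite eqEcard mul_subG ?(normal_sub nT) //=.
by rewrite TI_cardMg // oT oS oF.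
Qed.

(** The subgroups of index 2 contain T, and the quotient by T is isomorphic to S. *)
Lemma card_index2_order12 S : S \subset F -> #|S| = 4 ->
  #|index_subgroups F 2| = (if cyclic S then 1 else 3)%N.
Proof.
move=> SF oS; rewrite (index_subgroups_quotient nT) ?oT //.
rewrite -(index_subgroups_isog _ (sdprod_isog (order12_sdprod SF oS))).
exact: card_index2_order4.
Qed.

(** Their number is odd and divides 12. It is 1 exactly when S is normal, and then
    F is the direct product of two abelian groups. *)
Lemma card_index3_order12 :
  #|index_subgroups F 3| = (if abelian F then 1 else 3)%N.
Proof.
have Syl M : (M \in index_subgroups F 3) = (2.-Sylow(F) M).
  by rewrite inE pHallE oF p_part -[12]/(4 * 3)%N eqn_pmul2r.
have -> : #|index_subgroups F 3| = #|'Syl_2(F)|.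
  by apply: eq_card => M; rewrite Syl inE.
have [S SF oS] := order12_Sylow.
have sylS : 2.-Sylow(F) S by rewrite -Syl inE SF oS oF.
have abS : abelian S by apply: (card_p2group_abelian (p := 2)).
have abT : abelian T by rewrite cyclic_abelian ?prime_cyclic ?oT.
have [nTS _ defF _ tiTS] := sdprod_context (order12_sdprod SF oS).
have sS := order12_sdprod SF oS.
have cases : #|'Syl_2(F)| = 1%N \/ #|'Syl_2(F)| = 3.
  have := card_Syl_mod F (isT : prime 2); have := card_Syl_dvd 2 F; rewrite oF.
  by move: #|_|; do 13?[case=> //]; auto; move=> n /dvdn_leq.
have [abF|nabF] := boolP (abelian F); case: cases => // o.
  have := card_Syl sylS; rewrite o => /esym e; exfalso.
  have : F \subset 'N(S) by apply: sub_abelian_norm.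
  by move/setIidPl => eN; move: e; rewrite eN indexgg.
case/negP: nabF; have := card_Syl sylS; rewrite o => /esym/eqP.
rewrite indexg_eq1 subsetI subxx /= => nSF.
have cTS : T \subset 'C(S).
  apply/commG1P/trivgP; rewrite -tiTS subsetI commg_subl commg_subr.
  rewrite (subset_trans SF (normal_norm nT)) (subset_trans (normal_sub nT) nSF) //.
by have /sdprodP[_ <- _ _] := sS; rewrite abelianM abT abS /= centsC.
Qed.

Lemma order12_der : ~~ abelian F -> F^`(1) = T.
Proof.
move=> nabF; have [S SF oS] := order12_Sylow.
have sub : F^`(1) \subset T.
  apply: der1_min (normal_norm nT) _.
  rewrite -(isog_abelian (sdprod_isog (order12_sdprod SF oS))).
  exact: (card_p2group_abelian (p := 2)).
apply/eqP; rewrite eqEsubset sub /=; apply: contraR nabF => nsub.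
have : T :&: F^`(1) = 1 by apply: prime_TIg; rewrite ?oT.
by rewrite (setIidPr sub) => /derG1P.
Qed.

End NormalSylow3.

Lemma abelian12_Sylow3 : abelian F -> exists2 T : {group gT}, T <| F & #|T| = 3.
Proof.
move=> abF; have [a Fa oa] : {x | x \in F & #[x] = 3} by apply: Cauchy; rewrite ?oF.
exists <[a]>%G => //; rewrite -?orderE ?oa // /normal cycle_subG Fa /=.
by apply: sub_abelian_norm; rewrite // cycle_subG.
Qed.

(** A group of order 6 has a characteristic Sylow 3-subgroup, so a subgroup of
    index 2 would yield a normal subgroup of order 3. *)
Lemma no_index2 : (forall T : {group gT}, T <| F -> #|T| <> 3) ->
  index_subgroups F 2 = set0.
Proof.
move=> noT; apply/setP=> M; rewrite in_set0; apply/negP; rewrite inE => /andP[MF oM].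
have {}oM : #|M| = 6 by apply/eqP; rewrite -(eqn_pmul2r (isT : 0 < 2)) (eqP oM) oF.
have nM : M <| F by apply: index2_normal; rewrite // -divgS // oF oM.
have [T sylT] := Sylow_exists 3 M.
have oT : #|T| = 3 by rewrite (card_Hall sylT) oM p_part.
apply: (noT T) oT; apply: char_normal_trans nM.
have nTM : T <| M.
  have oS : #|'Syl_3(M)| = 1%N.
    have := card_Syl_mod M (isT : prime 3); have := card_Syl_dvd 3 M; rewrite oM.
    by move: #|_|; do 7?[case=> //]; move=> n /dvdn_leq.
  rewrite /normal (pHall_sub sylT) /=.
  have := card_Syl sylT; rewrite oS => /esym/eqP.
  by rewrite indexg_eq1 subsetI subxx.
by rewrite -(normal_Hall_pcore sylT nTM) pcore_char.
Qed.

Lemma order12_quotient K : K <| F -> (#|F / K| * #|K|)%N = 12.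
Proof. by move=> nK; rewrite -oF -divg_normal // divnK // cardSg ?normal_sub. Qed.

Lemma cyclic_quotient_index2 K : K <| F -> cyclic (F / K) -> 2 %| #|F / K| ->
  exists M : {group gT}, M \in index_subgroups F 2.
Proof.
move=> nK /cyclicP[g defg] d2; pose L := <[g ^+ 2]>%G.
have LF : L \subset F / K by rewrite defg cycle_subG mem_cycle.
have oL : (#|L| * 2)%N = #|F / K|.
  by rewrite -orderE orderXdiv orderE -defg // divnK.
have [M defM KM MF] := inv_quotientS nK LF.
exists M; rewrite inE MF /= -(eqn_pmul2r (isT : 0 < 2)).
have nKM := normalS KM MF nK.
have oM : (#|M / K| * #|K|)%N = #|M|.
  by rewrite -divg_normal // divnK // cardSg ?normal_sub.
by rewrite -oM -defM mulnAC oL order12_quotient // oF.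
Qed.

(** A quotient of even order would have a subgroup of index 2. If K were cyclic of
    order 4, its subgroup of order 2 would be normal in F, and with an element
    of order 3 it would generate a subgroup of index 2. *)
Lemma no_normal3_kernel K : (forall T : {group gT}, T <| F -> #|T| <> 3) ->
  K <| F -> cyclic (F / K) -> K :=: F \/ (#|K| = 4 /\ ~~ cyclic K).
Proof.
move=> noT nK cFK; have no2 := no_index2 noT.
have KF := normal_sub nK.
have d2 : ~~ (2 %| #|F / K|).
  by apply/negP=> /(cyclic_quotient_index2 nK cFK)[M]; rewrite no2 inE.
have oK : #|K| = 12 \/ #|K| = 4.
  have := order12_quotient nK; move: d2; case: #|F / K| => [|[|[|[|n]]]] //= d2 e.
  - by left; rewrite -e mul1n.
  - by right; apply/eqP; rewrite -(eqn_pmul2l (isT : 0 < 3)) e.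
  - have : n.+4 %| 12 by rewrite -e dvdn_mulr.
    by move: d2; clear; do 9?[case: n => [|n] //]; move=> _ /dvdn_leq.
case: oK => oK; [left | right].
  by apply/eqP; rewrite eqEcard KF oF oK.
split=> //; apply/negP=> cK.
have [x Kx ox] : {x | x \in K & #[x] = 2} by apply: Cauchy; rewrite ?oK.
have nZ : <[x]> <| F.
  by apply: char_normal_trans nK; rewrite sub_cyclic_char // cycle_subG.
have [t Ft ot] : {x | x \in F & #[x] = 3} by apply: Cauchy; rewrite ?oF.
have tN : <[t]> \subset 'N(<[x]>).
  by rewrite cycle_subG (subsetP (normal_norm nZ)).
have : (<[x]> <*> <[t]>)%G \in index_subgroups F 2.
  rewrite inE join_subG !cycle_subG Ft (subsetP KF) //= norm_joinEr //.
  by rewrite coprime_cardMg -?orderE ox ot // oF.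
by rewrite no2 inE.
Qed.

End Order12.

(** The alternating group acts 2-transitively, hence primitively, so a nontrivial
    normal subgroup is transitive and its order is divisible by 4. *)
Lemma Alt4_no_normal3 (T : {group {perm 'I_4}}) : T <| 'Alt_('I_4) -> #|T| <> 3.
Proof.
move=> nT oT.
have o4 : #|'I_4| = 4 by rewrite card_ord.
have tr : [transitive^2 'Alt_('I_4), on setT | 'P].
  by have := Alt_trans 'I_4; rewrite o4.
have prim := ntransitive_primitive (isT : 1 < 2) tr.
case: (prim_trans_norm prim nT) => [c|trT].
  by have := trivGP (subset_trans c (aperm_faithful _)) => e; rewrite e cards1 in oT.
by have := atrans_dvd trT; rewrite cardsT o4 oT.
Qed.

Lemma isog_no_normal3 (gT rT : finGroupType) (F : {group gT}) (G : {group rT}) :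
  F \isog G -> (forall T : {group rT}, T <| G -> #|T| <> 3) ->
  forall T : {group gT}, T <| F -> #|T| <> 3.
Proof.
case/isogP=> f injf defG noT T nT oT; apply: (noT (f @* T)%G).
  by rewrite -defG morphim_normal.
by rewrite card_injm // normal_sub.
Qed.

Section Presentations.
Variables (gT : finGroupType) (F : {group gT}).
Hypothesis oF : #|F| = 12.

Lemma join_cycles (x y : gT) m n : 0 < m -> 0 < n -> (m * n)%N = 12 ->
    <[x]> <*> <[y]> = F -> x ^+ m = 1 -> y ^+ n = 1 -> y \in 'N(<[x]>) ->
  [/\ #[x] = m, #[y] = n & F :=: <[x]> * <[y]>].
Proof.
move=> m0 n0 mn defF xm yn yN.
have defM : F :=: <[x]> * <[y]> by rewrite -defF norm_joinEr // cycle_subG.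
have lx : #[x] <= m by rewrite dvdn_leq // order_dvdn xm.
have ly : #[y] <= n by rewrite dvdn_leq // order_dvdn yn.
have := mul_cardG <[x]> <[y]>; rewrite -defM oF -mn -!orderE => e.
have le : m * n <= #[x] * #[y].
  by rewrite e leq_pmulr // cardG_gt0.
have ex : #[x] = m.
  apply/eqP; rewrite eqn_leq lx /= -(leq_pmul2r n0).
  by apply: leq_trans le _; rewrite leq_mul2l ly orbT.
split=> //; apply/eqP; rewrite eqn_leq ly /= -(leq_pmul2l m0).
by rewrite -{2}ex.
Qed.

Lemma dihedral12 : F \isog 'D_12 ->
  [/\ ~~ abelian F, exponent F %| 6 & exists2 T : {group gT}, T <| F & #|T| = 3].
Proof.
have G12 : 'D_12 \isog Grp (x : y : x ^+ 6, y ^+ 2, x ^ y = x^-1).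
  exact: (@Grp_dihedral 6 isT).
case/(isoGrpP _ G12) => _ /existsP[[x y]] /=; rewrite !xpair_eqE /=.
case/and4P=> /eqP defF /eqP x6 /eqP y2 /eqP xy.
have yN : y \in 'N(<[x]>) by rewrite -cycle_subG norms_cycle xy groupV cycle_id.
have [ox oy defM] := join_cycles (isT : 0 < 6) (isT : 0 < 2) erefl defF x6 y2 yN.
have ox2 : #[x ^+ 2] = 3 by rewrite orderXdiv ox.
have Fx : x \in F by rewrite -cycle_subG -defF joing_subl.
have Fy : y \in F by rewrite -cycle_subG -defF joing_subr.
split.
- apply/negP=> /centsP/(_ x Fx y Fy)/commgP/conjg_fixP; rewrite xy => e.
  have : x ^+ 2 = 1 by rewrite expgS expg1 -{1}e mulVg.
  by move=> e2; rewrite e2 order1 in ox2.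
- apply/exponentP=> g; rewrite defM => /mulsgP[u z /cycleP[i ->] zy ->{g}].
  move: zy; rewrite cycle2g // !inE => /orP[/eqP->|/eqP->].
    by rewrite mulg1 expgAC x6 expg1n.
  have e1 : (x ^+ i * y) ^+ 2 = 1.
    have e0 : x ^+ i * y = y * x ^- i by rewrite conjgC conjXg xy expVgn.
    by rewrite expgS expg1 {1}e0 mulgA mulgKV -[X in X * _]expg1 -expgSr y2.
  by rewrite (expgM _ 2 3) e1 expg1n.
- exists <[x ^+ 2]>%G; rewrite -?orderE // /normal cycle_subG groupX //=.
  have c1 : (x ^+ 2) ^ x = x ^+ 2 by rewrite conjgE -expgSr expgS mulKg.
  have c2 : (x ^+ 2) ^ y = x ^- 2 by rewrite conjXg xy expVgn.
  by rewrite -defF join_subG !norms_cycle c1 c2 groupV cycle_id.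
Qed.

Lemma dicyclic12 : F \isog Grp (x : y : x ^+ 3, y ^+ 4, y * x * y^-1 = x ^+ 2) ->
  [/\ ~~ abelian F, exists2 T : {group gT}, T <| F & #|T| = 3,
      exists S : {group gT}, [/\ S \subset F, #|S| = 4 & cyclic S]
    & exists C : {group gT}, [/\ C \subset F, #|C| = 6 & cyclic C]].
Proof.
move=> isoF; have : F \homg Grp (x : y : x ^+ 3, y ^+ 4, y * x * y^-1 = x ^+ 2).
  by rewrite -isoF homg_refl.
case/existsP=> -[x y] /=; rewrite !xpair_eqE /=.
case/and4P=> /eqP defF /eqP x3 /eqP y4 /eqP xy.
have xy' : x ^ y^-1 = x ^+ 2 by rewrite conjgE invgK mulgA.
have yN : y \in 'N(<[x]>).
  by rewrite -groupV -cycle_subG norms_cycle xy' mem_cycle.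
have [ox oy defM] := join_cycles (isT : 0 < 3) (isT : 0 < 4) erefl defF x3 y4 yN.
have Fx : x \in F by rewrite -cycle_subG -defF joing_subl.
have Fy : y \in F by rewrite -cycle_subG -defF joing_subr.
split.
- apply/negP=> /centsP/(_ x Fx y^-1 (groupVr Fy))/commgP/conjg_fixP; rewrite xy' => e.
  have : x = 1 by apply: (mulgI x); rewrite mulg1 -[RHS]e expgS expg1.
  by move=> e2; rewrite e2 order1 in ox.
- exists <[x]>%G; rewrite -?orderE // /normal cycle_subG Fx -defF join_subG.
  by rewrite normG cycle_subG.
- by exists <[y]>%G; rewrite cycle_subG Fy -orderE cycle_cyclic.
- exists <[x * y ^+ 2]>%G; rewrite cycle_subG groupM ?groupX // -orderE cycle_cyclic.
  rewrite orderM ?ox ?orderXdiv ?oy //.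
  apply/commute_sym/commute_sym/commgP/conjg_fixP.
  have : x ^ (y^-1 * y^-1) = x.
    by rewrite conjgM xy' conjXg xy' -expgM -[(2 * 2)%N]/(1 + 3)%N expgD x3 mulg1.
  by rewrite -invMg -[y * y]/(y ^+ 2) => e; rewrite -{1}e -conjgM mulVg conjg1.
Qed.

End Presentations.

Lemma exponent_Z6Z2 : exponent (setX (Zp 6) (Zp 2)) %| 6.
Proof.
apply/exponentP=> -[a b] _; apply/eqP.
by case: b => [[|[|b]] ib] //; case: a => [[|[|[|[|[|[|a]]]]]] ia].
Qed.

Lemma abelian_Z6Z2 : abelian (setX (Zp 6) (Zp 2)).
Proof. by apply/centsP=> -[a b] _ [c d] _; congr (_, _); apply: addrC. Qed.

(** * The number of cyclic Hopf Galois structures *)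

Section Count.
Variables (p : nat) (p_pr : prime p) (p_ge7 : 7 <= p).
Variables (fT : finGroupType) (F : {group fT}) (oF : #|F| = 12).
Variable tau : {morphism F >-> {unit 'Z_p}}.
Variables (k : fieldType) (K : splittingFieldType k) (galK : galois 1 {:K}).
Hypothesis isoG : 'Gal({:K} / 1) \isog [set: semidirect tau].
Local Notation gT := (gal_of {:K}).

Lemma galT : 'Gal({:K} / 1) = [set: gT].
Proof. by apply/setP=> g; rewrite gal_full inE. Qed.

Lemma gp_groups_cyclic n : #|[set: gT]| = n -> 0 < n ->
  #|gp_groups K (Zp_group n)| = #|cyclic_regular gT|.
Proof.
move=> on n0; apply: eq_card => N; rewrite !inE /regular galT.
have -> : [set ltrans g | g in [set: gT]] = [set rtransl g | g : gT].
  apply/setP=> s; apply/imsetP/imsetP=> -[g _ ->]; exists g; rewrite ?inE //;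
  by apply/permP=> x; rewrite ltransE rtranslE.
apply: andb_id2l => regN; apply: andb_id2l => _.
have oN : #|N| = n by rewrite (card_regular (regN : regular N)) -cardsT on.
apply/idP/idP=> [iN|cN]; last exact: cyclic_isog_Zp.
by rewrite (isog_cyclic iN) cyclic_Zp.
Qed.

Lemma num_hopfGalois_formula :
  num_hopfGalois K (Zp_group (12 * p))
    (#|index_subgroups F 2| * #|index_subgroups F 3| *
     (if 'ker tau == F then 1%N else p)).
Proof.
have p_gt4 : 4 < p by apply: leq_trans p_ge7.
have ndvd d : 0 < d < 5 -> ~~ (p %| d).
  case/andP=> d0 d5; apply/negP=> /(dvdn_leq d0); rewrite leqNgt.
  by rewrite (leq_trans d5).
have cop : coprime p #|F|.
  by rewrite oF prime_coprime // (Euclid_dvdM 4 3) // negb_or !ndvd.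
have oG : #|[set: gT]| = (12 * p)%N.
  have := card_isog isoG; rewrite /= galT => ->.
  by rewrite card_semidirect // oF mulnC.
have isoG' : [set: semidirect tau] \isog [set: gT].
  by rewrite isog_sym; move: isoG; rewrite /= galT.
have [P nP oP] : exists2 P : {group gT}, P <| [set: gT] & #|P| = p.
  have /isogP[g injg img] := isoG'.
  exists (g @* (sdpair1 (tau_groupAction tau) @* [set: 'Z_p]))%G.
    by rewrite -img morphim_normal // kernel_part_normal.
  by rewrite card_injm ?subsetT // card_kernel_part.
rewrite -[X in num_hopfGalois K _ X](_ : #|gp_groups K (Zp_group (12 * p))| = _).
  exact: num_hopfGalois_gp_groups.
rewrite (gp_groups_cyclic oG) ?muln_gt0 ?(prime_gt0 p_pr) //.
rewrite (card_cyclic_regular_12p p_pr p_gt4 oG nP oP).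
rewrite -!(index_subgroups_isog _ isoG') card_index_semidirect_p //.
by rewrite !card_index_semidirect // ndvd.
Qed.

End Count.

Section Kernels.
Variables (p : nat) (p_pr : prime p).
Variables (fT : finGroupType) (F : {group fT}) (oF : #|F| = 12).
Variable tau : {morphism F >-> {unit 'Z_p}}.
Local Notation ker := ('ker tau)%G.

Lemma ker_tau_normal : ker <| F.
Proof. exact: ker_normal. Qed.

Lemma ker_tau_cyclic : cyclic (F / ker).
Proof.
rewrite (isog_cyclic (first_isog tau)).
by apply: cyclicS (units_Zp_cyclic p_pr); apply: subsetT.
Qed.

Lemma ker_tau_card : (#|F / ker| * #|ker|)%N = 12.
Proof. exact: (order12_quotient oF ker_tau_normal). Qed.

Lemma ker_tau_full : #|ker| = 12 -> ker = F.
Proof.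
move=> oK; apply/group_inj/eqP; rewrite eqEcard (normal_sub ker_tau_normal) /=.
by rewrite oF oK.
Qed.

Lemma isog_ker_proper (rT : finGroupType) (H : {group rT}) :
  'ker tau \isog H -> #|H| < 12 -> ('ker tau == F) = false.
Proof.
by move=> /card_isog iK lt; apply/eqP=> e; move: lt; rewrite -iK /= e oF.
Qed.

Lemma ker_tau_exponent6 : exponent F %| 6 -> #|F / ker| %| 6.
Proof.
move=> e6; rewrite -(exponent_cyclic ker_tau_cyclic).
exact: dvdn_trans (exponent_quotient _ _) e6.
Qed.

(** The kernel contains the derived subgroup of F, which is T. *)
Lemma ker_tau_der (T : {group fT}) : T <| F -> #|T| = 3 -> ~~ abelian F ->
  #|F / ker| %| 4.
Proof.
move=> nT oT nab; have d3 : 3 %| #|ker|.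
  rewrite -oT cardSg // -(order12_der oF nT oT nab).
  exact: der1_min (normal_norm ker_tau_normal) (cyclic_abelian ker_tau_cyclic).
by rewrite -(dvdn_pmul2r (isT : 0 < 3)) -[(4 * 3)%N]ker_tau_card dvdn_pmul2l ?cardG_gt0.
Qed.

End Kernels.

Theorem mainTheorem5 (p : nat) (p_pr : prime p) (p_ge7 : 7 <= p)
    (fT : finGroupType) (F : {group fT}) (oF : #|F| = 12)
    (tau : {morphism F >-> {unit 'Z_p}})
    (k : fieldType) (K : splittingFieldType k) (galK : galois 1 {:K})
    (isoG : 'Gal({:K} / 1) \isog [set: semidirect tau]) :
  [/\ F \isog Zp 12 ->
        [/\ [|| 'ker tau == F, 'ker tau \isog Zp 6, 'ker tau \isog Zp 4,
                'ker tau \isog Zp 3, 'ker tau \isog Zp 2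
              | 'ker tau \isog Zp 1],
            'ker tau = F -> num_hopfGalois K (Zp_group (12 * p)) 1
          & [|| 'ker tau \isog Zp 6, 'ker tau \isog Zp 4, 'ker tau \isog Zp 3,
                'ker tau \isog Zp 2 | 'ker tau \isog Zp 1] ->
            num_hopfGalois K (Zp_group (12 * p)) p],
      F \isog setX (Zp 6) (Zp 2) ->
        [/\ [|| 'ker tau == F, 'ker tau \isog Zp 6,
                'ker tau \isog setX (Zp 2) (Zp 2) | 'ker tau \isog Zp 2],
            'ker tau = F -> num_hopfGalois K (Zp_group (12 * p)) 3
          & [|| 'ker tau \isog Zp 6, 'ker tau \isog setX (Zp 2) (Zp 2)
              | 'ker tau \isog Zp 2] ->
            num_hopfGalois K (Zp_group (12 * p)) (3 * p)],
      F \isog 'Alt_('I_4) ->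
        [/\ ('ker tau == F) || ('ker tau \isog setX (Zp 2) (Zp 2)),
            'ker tau = F -> num_hopfGalois K (Zp_group (12 * p)) 0
          & 'ker tau \isog setX (Zp 2) (Zp 2) ->
            num_hopfGalois K (Zp_group (12 * p)) 0],
      F \isog 'D_12 ->
        [/\ [|| 'ker tau == F, 'ker tau \isog Zp 6 | 'ker tau \isog 'D_6],
            'ker tau = F -> num_hopfGalois K (Zp_group (12 * p)) 9
          & ('ker tau \isog Zp 6) || ('ker tau \isog 'D_6) ->
            num_hopfGalois K (Zp_group (12 * p)) (9 * p)]
    & F \isog Grp (x : y : x ^+ 3, y ^+ 4, y * x * y^-1 = x ^+ 2) ->
        [/\ [|| 'ker tau == F, 'ker tau \isog Zp 6 | 'ker tau \isog Zp 3],
            'ker tau = F -> num_hopfGalois K (Zp_group (12 * p)) 3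
          & ('ker tau \isog Zp 6) || ('ker tau \isog Zp 3) ->
            num_hopfGalois K (Zp_group (12 * p)) (3 * p)]].
Proof.
have count := num_hopfGalois_formula p_pr p_ge7 oF galK isoG.
have full : ('ker tau = F) -> ('ker tau == F) by move->.
have oK := ker_tau_card oF tau.
have kZ n : 0 < n -> cyclic ('ker tau) -> #|'ker tau| = n -> 'ker tau \isog Zp n.
  exact: cyclic_isog_Zp.
have kF : #|'ker tau| = 12 -> 'ker tau == F.
  by move/(ker_tau_full oF)/(congr1 (@gval _))/eqP.
have propZ n : 0 < n < 12 -> 'ker tau \isog Zp n -> ('ker tau == F) = false.
  case/andP=> n0 n12 iK; apply: (isog_ker_proper oF (H := Zp_group n) iK).
  by rewrite card_Zp.
have propV : 'ker tau \isog setX (Zp 2) (Zp 2) -> ('ker tau == F) = false.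
  by move=> iK; apply: (isog_ker_proper oF iK); rewrite cardsX !card_Zp.
have propD : 'ker tau \isog 'D_6 -> ('ker tau == F) = false.
  by move=> iK; apply: (isog_ker_proper oF iK); rewrite (@card_dihedral 3 isT).
have kerF : 'ker tau \subset F := normal_sub (ker_tau_normal tau).
have divK q n m : 0 < q -> (q * m)%N = (q * n)%N -> m = n.
  by move=> q0 /eqP; rewrite eqn_pmul2l // => /eqP.
have [S SF oS] := order12_Sylow oF.
split=> isoF.
- have cF : cyclic F.
    by rewrite (isog_cyclic isoF) cyclic_Zp.
  have [T nT oT] := abelian12_Sylow3 oF (cyclic_abelian cF).
  have cK : cyclic ('ker tau) by apply: cyclicS cF; apply: normal_sub (ker_tau_normal tau).
  move: count; rewrite (card_index2_order12 oF nT oT SF oS) (cyclicS SF cF).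
  rewrite (card_index3_order12 oF nT oT) (cyclic_abelian cF) !mul1n => count.
  split=> [|/full e|]; first 1 last.
  + by rewrite e in count.
  + move=> iK; suff e : ('ker tau == F) = false by rewrite e in count.
    by case/orP: iK => [/propZ->|/or4P[]/propZ->].
  have : #|'ker tau| %| 12 by rewrite -oK dvdn_mull.
  move: (kZ _ (cardG_gt0 _) cK erefl) kF.
  case: #|_| => [|[|[|[|[|[|[|[|[|[|[|[|[|n]]]]]]]]]]]]] //= iK kf;
    by [rewrite iK !orbT | rewrite kf].
- have e6 : exponent F %| 6 by rewrite (exponent_isog isoF) exponent_Z6Z2.
  have abF : abelian F by rewrite (isog_abelian isoF) abelian_Z6Z2.
  have [T nT oT] := abelian12_Sylow3 oF abF.
  have nc4 (Q : {group fT}) : Q \subset F -> #|Q| = 4 -> ~~ cyclic Q.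
    by move=> QF oQ; apply: exponent6_noncyclic4 oQ (dvdn_trans (exponentS QF) e6).
  move: count; rewrite (card_index2_order12 oF nT oT SF oS) (negPf (nc4 S SF oS)).
  rewrite (card_index3_order12 oF nT oT) abF muln1 => count.
  split=> [|/full e|]; first 1 last.
  + by rewrite e in count.
  + move=> iK; suff e : ('ker tau == F) = false by rewrite e in count.
    by case/or3P: iK => [/propZ->|/propV|/propZ->].
  have := ker_tau_exponent6 p_pr tau e6; move: oK.
  case: #|_ / _| => [|[|[|[|[|[|[|n]]]]]]] //.
  + by rewrite mul1n => oK _; rewrite kF.
  + move/(divK 2 6 _ isT) => oK _; rewrite (kZ 6) ?orbT //.
    by apply: card6_cyclic oK (abelianS kerF abF).
  + move/(divK 3 4 _ isT) => oK _.
    by rewrite (isog_Klein oK) ?orbT // nc4.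
  + move/(divK 6 2 _ isT) => oK _; rewrite (kZ 2) ?orbT //.
    by rewrite prime_cyclic ?oK.
- have noT := isog_no_normal3 isoF Alt4_no_normal3.
  move: count; rewrite (no_index2 oF noT) cards0 !mul0n => count.
  split=> //.
  case: (no_normal3_kernel oF noT (ker_tau_normal tau) (ker_tau_cyclic p_pr tau)).
    by move/full->.
  by case=> o4 nc; rewrite (isog_Klein o4 nc) orbT.
- have [nab e6 [T nT oT]] := dihedral12 oF isoF.
  have nc4 : ~~ cyclic S.
    exact: exponent6_noncyclic4 oS (dvdn_trans (exponentS SF) e6).
  move: count; rewrite (card_index2_order12 oF nT oT SF oS) (negPf nc4).
  rewrite (card_index3_order12 oF nT oT) (negPf nab) => count.
  split=> [|/full e|]; first 1 last.
  + by rewrite e in count.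
  + move=> iK; suff e : ('ker tau == F) = false by rewrite e in count.
    by case/orP: iK => [/propZ->|/propD].
  have := ker_tau_der p_pr oF tau nT oT nab; have := ker_tau_exponent6 p_pr tau e6.
  move: oK; case: #|_ / _| => [|[|[|[|[|[|[|n]]]]]]] //.
  + by rewrite mul1n => oK _ _; rewrite kF.
  + move/(divK 2 6 _ isT) => oK _ _.
    by case: (card6_cases oK) => iK; rewrite ?iK ?(kZ 6 isT iK oK) ?orbT.
- have [nab [T nT oT] [S' [SF' oS' cS']] [C [CF oC cC]]] := dicyclic12 oF isoF.
  have idx := card_index2_order12 oF nT oT SF' oS'; rewrite cS' in idx.
  move: count; rewrite idx (card_index3_order12 oF nT oT) (negPf nab) mul1n => count.
  split=> [|/full e|]; first 1 last.
  + by rewrite e in count.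
  + move=> iK; suff e : ('ker tau == F) = false by rewrite e in count.
    by case/orP: iK => [/propZ->|/propZ->].
  have := ker_tau_der p_pr oF tau nT oT nab.
  move: oK; case: #|_ / _| => [|[|[|[|[|n]]]]] //.
  + by rewrite mul1n => oK _; rewrite kF.
  + move/(divK 2 6 _ isT) => oK _.
    (* The kernel has index 2, as has the cyclic subgroup C, and there is only one
       such subgroup. *)
    have /cards1P[M idxE] : #|index_subgroups F 2| == 1%N by rewrite idx.
    have inM (L : {group fT}) : L \subset F -> #|L| = 6 -> L = M.
      by move=> LF oL; apply/set1P; rewrite -idxE inE LF oL oF.
    rewrite (kZ 6) ?orbT //; suff e : ('ker tau)%G = C by have := cC; rewrite -e.
    by rewrite (inM C) // (inM ('ker tau)%G).
  + move/(divK 4 3 _ isT) => oK _; rewrite (kZ 3) ?orbT //.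
    by rewrite prime_cyclic ?oK.
Qed.
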